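(* Let $\lambda$ be a partition of $n$, let $\rho=(\rho_1,\ldots,\rho_r)$ be a partition (positive parts) with $|\rho|\le n$, and let $\mu=(\rho_1,\ldots,\rho_r,1^{n-|\rho|})$. Then \[(n)_{|\rho|}\,\hat\chi^\lambda_\mu=\sum_{\varepsilon\in\{0,2\}^{r(r-1)/2}}\ \sum_{(i_1,\ldots,i_r)\in\mathbb{N}^r}A^{(\varepsilon)}_{i_1,\ldots,i_r}(\rho_1,\ldots,\rho_r)\prod_{k=1}^r c^\lambda_{i_k}(\rho_k),\] where \begin{multline*} A^{(\varepsilon)}_{i_1,\ldots,i_r}(\rho_1,\ldots,\rho_r)=\sum_{a,b\in\mathsf{M}^{(r)}}\Bigg(\prod_{1\le i<j\le r}\theta_{ij}\binom{a_{ij}+1}{b_{ij}+1}\frac{\rho_i(-\rho_i)^{b_{ij}}+\rho_j^{\,b_{ij}+1}}{\rho_i+\rho_j}\Bigg)\\ \times\prod_{k=1}^r s\Big(\rho_k+1,\ i_k+\sum_{l<k}(a_{lk}+\varepsilon_{lk})-\sum_{l>k}(a_{kl}-b_{kl})\Big), \end{multline*} with the convention that, for each pair $i<j$ with $\varepsilon_{ij}=0$, the summation over $a_{ij},b_{ij}$ is restricted to $a_{ij}=b_{ij}=0$.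
   Context: $\chi^\lambda_\mu$ is the value of the irreducible character of $S_n$ indexed by $\lambda$ at a permutation of cycle type $\mu$; $\hat\chi^\lambda_\mu=\chi^\lambda_\mu/\dim\lambda$ with $\dim\lambda=\chi^\lambda_{1^n}$. $(n)_m=n(n-1)\cdots(n-m+1)$; $\mathbb{N}=\{0,1,2,\ldots\}$. The Stirling numbers of the first kind are defined by $(z)_m=\sum_t s(m,t)z^t$, with $s(m,t)=0$ unless $1\le t\le m$ (in particular for negative $t$). An element $\varepsilon\in\{0,2\}^{r(r-1)/2}$ is a family $(\varepsilon_{ij})_{1\le i<j\le r}$ with each $\varepsilon_{ij}\in\{0,2\}$; $\theta_{ij}=1$ if $\varepsilon_{ij}=0$ and $\theta_{ij}=\rho_i\rho_j$ if $\varepsilon_{ij}=2$. $\mathsf{M}^{(r)}$ is the set of upper triangular $r\times r$ matrices with nonnegative integer entries and zero diagonal; $a=(a_{ij})$, $b=(b_{ij})$. For a partition $\lambda$ (with $l=l(\lambda)$) and an indeterminate $x$, the quantities $c^\lambda_m(x)$, $m\ge0$, are defined by the expansion in descending powers of $y$ \[\frac{C_\lambda(x-y+1)}{C_\lambda(x-y)}\,\frac{C_\lambda(-y)}{C_\lambda(-y+1)}=\prod_{i=1}^{l}\frac{(x-y+1+\lambda_i-i)(-y+1-i)}{(x-y+1-i)(-y+1+\lambda_i-i)}=-x\sum_{m\ge 0}c^\lambda_m(x)\,y^{-m},\] where $C_\lambda(z)=\prod_{(i,j)\in\lambda}(z+j-i)$ is the content polynomial. *)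

(* Defs.v *)
From mathcomp Require Import all_boot all_order all_algebra all_fingroup.
From mathcomp Require Import all_field all_character.
From mathcomp Require Import boolp classical_sets cardinality fsbigop.

Set Implicit Arguments.
Unset Strict Implicit.
Unset Printing Implicit Defensive.

Import Order.TTheory GRing.Theory Num.Theory.

Local Open Scope ring_scope.

Definition is_part (s : seq nat) : bool := sorted geq s && (0%N \notin s).

Definition conj_part (la : seq nat) : seq nat :=
  mkseq (fun j => count (leq j.+1) la) (head 0%N la).

Definition cycle_type (n : nat) (s : 'S_n) : seq nat :=
  sort geq [seq #|(c : {set 'I_n})| | c <- enum (porbits s)].

(* The Young subgroup of la |- n: the permutations preserving each of the     *)
(* consecutive blocks of 'I_n of sizes la_1, la_2, etc.; reshape_index la k   *)
(* is the number of the block containing k.                                   *)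
Definition young_set (n : nat) (la : seq nat) : {set 'S_n} :=
  [set s : 'S_n | [forall k, reshape_index la (s k) == reshape_index la k]].

Lemma young_group_set (n : nat) (la : seq nat) : group_set (young_set n la).
Proof.
apply/group_setP; split=> [|s t].
  by rewrite inE; apply/forallP=> k; rewrite perm1.
rewrite !inE => /forallP hs /forallP ht; apply/forallP=> k.
by rewrite permM (eqP (ht _)) (eqP (hs _)).
Qed.

Canonical young (n : nat) (la : seq nat) : {group 'S_n} :=
  Group (young_group_set n la).

Lemma sgn_subproof (n : nat) :
  is_class_fun <<[set: 'S_n]>>%g [ffun s : 'S_n => (-1) ^+ odd_perm s : algC].
Proof.
rewrite genGid; apply: intro_class_fun => [s t _ _|s].
  by rewrite odd_permJ.
by rewrite inE.
Qed.

Definition sgn (n : nat) : 'CF([set: 'S_n]) := Cfun 0 (sgn_subproof n).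

(* The irreducible character of 'S_n indexed by la |- n, as in James and      *)
(* Kerber: the unique common irreducible constituent of the characters        *)
(* induced from the trivial character of the Young subgroup of la and from    *)
(* the sign character of the Young subgroup of the conjugate partition. Thus  *)
(* (n) indexes the trivial and (1^n) the sign character. The default index 0  *)
(* is only reached when la is not a partition of n.                           *)
Definition part_Iirr (n : nat) (la : seq nat) : Iirr [set: 'S_n] :=
  odflt 0 [pick i |
    (i \in irr_constt ('Ind[[set: 'S_n], young n la] 1)) &&
    (i \in irr_constt ('Ind[[set: 'S_n], young n (conj_part la)]
                         ('Res[young n (conj_part la)] (sgn n))))].

Definition chi (n : nat) (la : seq nat) : 'CF([set: 'S_n]) :=
  'chi_(part_Iirr n la).

Definition chi_hat (n : nat) (la : seq nat) (s : 'S_n) : algC :=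
  chi n la s / chi n la 1%g.

Definition stirling1 (m : nat) (t : int) : int :=
  match t with
  | Posz k => (\prod_(j < m) ('X - (j%:R : int)%:P) : {poly int})`_k
  | Negz _ => 0
  end.

Section Expansion.
Variable F : fieldType.

(* The coefficient of y^-m, for m >= 0, in the expansion of P(y) / Q(y) in    *)
(* descending powers of y: the constant term of the polynomial part of        *)
(* y^m P(y) / Q(y). See desc_coefP.                                           *)
Definition desc_coef (P Q : {poly F}) (m : nat) : F := ((P * 'X^m) %/ Q)`_0.

Lemma desc_coefP (P Q : {poly F}) (m : nat) :
  Q != 0 -> (size P <= size Q)%N ->
  (size (P * 'X^m - Q * \sum_(k < m.+1) desc_coef P Q k *: 'X^(m - k))%R
     < size Q)%N.
Proof.
move=> Q0 sPQ.
have coefE j : (j <= m)%N -> ((P * 'X^m) %/ Q)`_j = desc_coef P Q (m - j).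
  move=> jm; rewrite -{1}(subnK jm) exprD mulrA {1}(divp_eq (P * 'X^(m - j)) Q).
  rewrite mulrDl mulrAC divpD mulpK // coefD coefMXn ltnn subnn.
  rewrite [X in _ + X]nth_default ?addr0 //.
  rewrite size_divp // leq_subLR (leq_trans (size_polyMleq _ _)) // size_polyXn.
  rewrite addnS /= leq_add2r.
  have : (size ((P * 'X^(m - j)) %% Q)%R < size Q)%N by rewrite ltn_modp.
  by case: (size Q).
suff -> : \sum_(k < m.+1) desc_coef P Q k *: 'X^(m - k) = (P * 'X^m) %/ Q.
  by rewrite {1}(divp_eq (P * 'X^m) Q) [_ %/ _ * _]mulrC addrC addKr ltn_modp.
have sz : (size ((P * 'X^m) %/ Q)%R <= m.+1)%N.
  rewrite size_divp // leq_subLR (leq_trans (size_polyMleq _ _)) // size_polyXn.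
  rewrite addnS /=; have : (0 < size Q)%N by rewrite size_poly_gt0.
  by case: (size Q) sPQ => // s sPs _; rewrite /= addnS -addSn leq_add2r.
rewrite (reindex_inj rev_ord_inj) /=.
apply/polyP=> j; rewrite coef_sum.
under eq_bigr => k _.
  rewrite coefZ coefXn subSS subKn; last by rewrite -ltnS ltn_ord.
  over.
case: (ltnP j m.+1) => jm.
  rewrite (bigD1 (Ordinal jm)) //= eqxx mulr1 big1 ?addr0 ?coefE // => k.
  by rewrite -val_eqE /= eq_sym => /negPf->; rewrite mulr0.
rewrite [RHS]nth_default ?(leq_trans sz) // big1 // => k _.
by rewrite gtn_eqF ?mulr0 // (leq_trans (ltn_ord k)).
Qed.

Definition content_poly (la : seq nat) : {poly F} :=
  \prod_(i < size la) \prod_(j < nth 0%N la i)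
    ('X + ((j%:Z - i%:Z)%:~R)%:P).

(* c^la_m(x), where 'X plays the role of y. The expansion is taken over an    *)
(* arbitrary field F containing x, with x nonzero: F may be a field of        *)
(* rational functions with x its indeterminate, or x may be a number.         *)
Definition c_coef (la : seq nat) (x : F) (m : nat) : F :=
  let C := content_poly la in
  - x^-1 * desc_coef
    ((C \Po ((x + 1)%:P - 'X)) * (C \Po (- 'X)))
    ((C \Po (x%:P - 'X)) * (C \Po (1 - 'X))) m.

End Expansion.

Local Open Scope classical_set_scope.

Section Coefficients.
Variable r : nat.

Definition upper_mx : set 'M[nat]_r :=
  [set a : 'M[nat]_r | forall i j : 'I_r, (j <= i)%N -> a i j = 0%N].

(* A family (e_ij)_(i < j) with values in {0, 2}, padded with zeros.          *)
Definition eps_set : set 'M[nat]_r :=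
  upper_mx `&`
  [set e : 'M[nat]_r |
     forall i j : 'I_r, (i < j)%N -> e i j = 0%N \/ e i j = 2%N].

Definition ab_set (e : 'M[nat]_r) : set ('M[nat]_r * 'M[nat]_r) :=
  [set ab : 'M[nat]_r * 'M[nat]_r |
     [/\ upper_mx ab.1, upper_mx ab.2
       & forall i j : 'I_r, (i < j)%N -> e i j = 0%N ->
           ab.1 i j = 0%N /\ ab.2 i j = 0%N]].

Variable rho : r.-tuple nat.

Definition theta (e : 'M[nat]_r) (i j : 'I_r) : nat :=
  if e i j == 0%N then 1%N else (tnth rho i * tnth rho j)%N.

Definition pair_weight (e a b : 'M[nat]_r) (i j : 'I_r) : algC :=
  let x : algC := (tnth rho i)%:R in
  let y : algC := (tnth rho j)%:R in
  (theta e i j)%:R * 'C((a i j).+1, (b i j).+1)%:R *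
  ((x * (- x) ^+ b i j + y ^+ (b i j).+1) / (x + y)).

Definition stirling_arg (e a b : 'M[nat]_r) (i : {ffun 'I_r -> nat})
    (k : 'I_r) : int :=
  (i k)%:Z
  + \sum_(l < r | (l < k)%N) ((a l k)%:Z + (e l k)%:Z)
  - \sum_(l < r | (k < l)%N) ((a k l)%:Z - (b k l)%:Z).

(* Only finitely many terms are nonzero: b_ij > a_ij makes the binomial       *)
(* coefficient vanish, and the condition stirling_arg <= rho_k + 1 bounds i_k *)
(* and the a_lk (l < k) for k = r - 1, r - 2, etc. in turn.                   *)
Definition Acoef (e : 'M[nat]_r) (i : {ffun 'I_r -> nat}) : algC :=
  \sum_(ab \in ab_set e)
    ((\prod_(p < r) \prod_(q < r | (p < q)%N) pair_weight e ab.1 ab.2 p q) *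
     \prod_(k < r)
       (stirling1 (tnth rho k).+1 (stirling_arg e ab.1 ab.2 i k))%:~R).

End Coefficients.

(* Main.v *)
(** Frobenius' formula: the value of chi^la at s is the coefficient of
    x^(la + delta) in the alternant times the product of the power sums p_m over
    the cycle lengths m of s. To identify the James-Kerber character with it, let
    psi be the alternating sum over w of the permutation characters on words of
    content la + delta - w delta. Cauchy's determinant gives psi norm 1. Pairing
    with the character induced from the sign kills all terms with w <> 1 (a pair
    of words with these contents and no repeated pair of letters would violate a
    sum of squares inequality) and gives 1 for w = 1; so the common constituent is
    unique, occurs once in psi, and equals psi.

    Extracting the coefficient, each part q of rho lowers one exponent by q, and
    the sum over the lowered exponent is minus the residue at infinity over q of a
    rational function Phi. Lowering the exponent z by r' multiplies the function
    Phi of a later part r by 1 + r r' / ((u + r') (u - r)), u = y - z; the two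
    terms correspond to eps = 0 and eps = 2, and a, b index the expansion of the
    second one at y = oo. A shift of y rewrites Phi through the contents of la,
    which produces the Stirling numbers and the coefficients c. *)
Require Import Defs.
From HB Require Import structures.
From mathcomp Require Import all_boot all_order all_algebra all_fingroup.
From mathcomp Require Import all_field all_character.
From mathcomp Require Import boolp classical_sets cardinality fsbigop.
From mathcomp Require Import ring zify.
From mathcomp Require Import mpoly.

Set Implicit Arguments.
Unset Strict Implicit.
Unset Printing Implicit Defensive.

Import Order.TTheory GRing.Theory Num.Theory.

Local Open Scope ring_scope.

(** * Residues at infinity *)

(** Removing a part may make two exponents equal or one of them negative. Hence the residue sum is
    carried multiplied by the Vandermonde product, which vanishes in the first case, while a falling
    factorial kills the terms of the second; the recursion then needs no case distinction. The
    expansions at y = oo are cut with an exact remainder of zero residue, so one truncation must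
    serve all parts at once. The obstacle is that a choice of a, b for a pair i < j raises the
    exponent of part i and lowers that of part j. The moment of part k vanishes below -(rho_k + 1),
    just as s(rho_k + 1, t) vanishes for t > rho_k + 1, and a weight increasing with k makes these
    conditions bound every a_ij. The exponents are shifted by l - 1 to become la_i - i, the contents
    just past the rows. This lets the number of rows disappear and leaves (y - 1)_r = (y)_(r+1) / y,
    whence s(rho_k + 1, .). Determinants are used up to an unspecified sign: it cancels in the
    normalised character, and positivity fixes it in the norm. *)

Lemma size_prod_subC (R : nzRingType) l (al : 'I_l -> R) (A : pred 'I_l) :
  size (\prod_(i | A i) ('X - (al i)%:P)) = #|A|.+1.
Proof.
rewrite -big_filter -(big_map al xpredT (fun a => 'X - a%:P)) size_prod_XsubC size_map.
by rewrite cardE /enum_mem.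
Qed.

Lemma eq_div_cross (K : fieldType) (p q m e : K) :
  q != 0 -> e != 0 -> p / q = m / e -> p * e = m * q.
Proof. by move=> q0 e0 /eqP; rewrite eqr_div // => /eqP. Qed.

Section FractionResidue.
Variable F : fieldType.
Local Notation repr := generic_quotient.repr.
Local Notation K := {fraction {poly F}}.
Local Notation "p %:F" := (@FracField.tofrac {poly F} p).
Implicit Types (P Q R : {poly F}) (x y : K) (c d : F).

Lemma frac_repr x : x = (\n_(repr x))%:F / (\d_(repr x))%:F.
Proof.
have d0 := denom_ratioP (repr x).
have d0F : (\d_(repr x))%:F != 0 :> K by rewrite tofrac_eq0.
apply: (canRL (mulfK d0F)); rewrite -{1}[x]reprK; unlock FracField.tofrac.
rewrite -[LHS]FracField.pi_mul.
apply/eqmodP; rewrite /= FracField.equivfE /FracField.mulf.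
by rewrite !numden_Ratio ?oner_eq0 ?mulr1 // mulrC.
Qed.

(** The coefficient of y^-1 in the expansion of P / Q at infinity, that is, minus the residue there:
    only the remainder contributes, through its coefficient one below the degree of Q. For constant
    Q the remainder is 0, so the truncated index is harmless. *)
Definition res_poly P Q : F := (P %% Q)`_(size Q).-2 / lead_coef Q.

Definition res x : F := res_poly \n_(repr x) \d_(repr x).

Lemma coefM_top P Q s :
  (size P <= s.+1)%N -> (P * Q)`_(s + (size Q).-1) = P`_s * lead_coef Q.
Proof.
move=> sP; rewrite coefM.
have slt : (s < (s + (size Q).-1).+1)%N by rewrite ltnS leq_addr.
rewrite (bigD1 (Ordinal slt)) //= addKn big1 ?addr0 // => j /negPf js.
case: (ssrnat.ltngtP j s) => [lt|gt|eq].
- rewrite [Q`__]nth_default ?mulr0 //; move: (size Q) (nat_of_ord j) lt => q a; lia.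
- by rewrite [P`__]nth_default ?mul0r // (leq_trans sP).
- by move: js; rewrite -val_eqE /= eq eqxx.
Qed.

(** As (P R) mod (Q R) = (P mod Q) R, the value depends on the fraction only. [resE] needs this
    because [repr] picks an arbitrary representative. *)
Lemma res_polyMr P Q R :
  Q != 0 -> R != 0 -> res_poly (P * R) (Q * R) = res_poly P Q.
Proof.
move=> Q0 R0; rewrite /res_poly lead_coefM.
have lQ : lead_coef Q != 0 by rewrite lead_coef_eq0.
have lR : lead_coef R != 0 by rewrite lead_coef_eq0.
have sQ : (0 < size Q)%N by rewrite size_poly_gt0.
have sR : (0 < size R)%N by rewrite size_poly_gt0.
have sPQ : (size (P %% Q)%R < size Q)%N by rewrite ltn_modp.
have -> : (P * R) %% (Q * R) = (P %% Q) * R.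
  rewrite {1}(divp_eq P Q) mulrDl -mulrA modp_addl_mul_small //.
  rewrite [X in (_ < X)%N]size_mul //; have [->|M0] := eqVneq (P %% Q) 0.
    by rewrite mul0r size_poly0; move: (size Q) (size R) sQ sR => q [|a]; lia.
  rewrite size_mul //; move: (size Q) (size R) (size (P %% Q)) sQ sR sPQ => q a b; lia.
case E: (size Q) => [|[|s]].
- by rewrite E in sQ.
- have -> : P %% Q = 0 by apply/eqP; rewrite -size_poly_eq0; move: sPQ; rewrite E; move: (size _) => a; lia.
  by rewrite !mul0r !coef0 !mul0r.
rewrite size_mul // E /=.
have -> : (s.+2 + size R).-1.-2 = (s + (size R).-1)%N by move: (size R) sR => a; lia.
rewrite coefM_top; last by rewrite -ltnS -E.
by field; rewrite lQ lR.
Qed.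

Lemma resE P Q : Q != 0 -> res (P%:F / Q%:F) = res_poly P Q.
Proof.
move=> Q0; move Ex: (_ / _) => x; rewrite /res.
have := denom_ratioP (repr x); have := frac_repr x.
move: (\n_(repr x)) (\d_(repr x)) => n d xE d0.
have d0F : d%:F != 0 :> K by rewrite tofrac_eq0.
have Q0F : Q%:F != 0 :> K by rewrite tofrac_eq0.
have : P%:F * d%:F = n%:F * Q%:F.
  by apply: (eq_div_cross Q0F d0F); exact: etrans Ex xE.
rewrite -!tofracM => /eqP; rewrite tofrac_eq => /eqP e.
by rewrite -(res_polyMr _ d0 Q0) -e mulrC [d * Q]mulrC mulrC res_polyMr.
Qed.

Lemma res_polyD P Q R : res_poly (P + Q) R = res_poly P R + res_poly Q R.
Proof. by rewrite /res_poly modpD coefD mulrDl. Qed.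

Lemma resD : {morph res : x y / x + y}.
Proof.
move=> x y.
have := denom_ratioP (repr x); have := frac_repr x.
have := denom_ratioP (repr y); have := frac_repr y.
rewrite {2 3}/res.
move: (\n_(repr x)) (\d_(repr x)) (\n_(repr y)) (\d_(repr y)) => a b c d.
move=> -> d0 -> b0.
have bF : b%:F != 0 :> K by rewrite tofrac_eq0.
have dF : d%:F != 0 :> K by rewrite tofrac_eq0.
have -> : a%:F / b%:F + c%:F / d%:F = (a * d + c * b)%:F / (b * d)%:F.
  by rewrite tofracD !tofracM; exact (addf_div _ _ bF dF).
rewrite (resE _ (mulf_neq0 b0 d0)) res_polyD.
by rewrite (res_polyMr _ b0 d0) [b * d]mulrC (res_polyMr _ d0 b0).
Qed.

Lemma resZ c x : res (c%:P%:F * x) = c * res x.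
Proof.
have e := frac_repr x; rewrite {1}e mulrA -tofracM (resE _ (denom_ratioP _)).
by rewrite /res /res_poly mul_polyC modpZl coefZ mulrA.
Qed.

End FractionResidue.

(** An interface to F(y): the rest of the proof handles rational functions and their residues
    through these laws alone. *)
Record residue_field (F : fieldType) := ResidueField {
  rf_field :> fieldType;
  rf_emb : {rmorphism {poly F} -> rf_field};
  rf_res : rf_field -> F;
  rf_emb_inj : injective rf_emb;
  rf_resE : forall P Q, Q != 0 -> rf_res (rf_emb P / rf_emb Q) = res_poly P Q;
  rf_resD : {morph rf_res : x y / x + y};
  rf_resZ : forall c x, rf_res (rf_emb c%:P * x) = c * rf_res x
}.

(* Opaque, to keep conversion from unfolding the quotient type of fractions. *)
Lemma rational_functions (F : fieldType) : residue_field F.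
Proof.
apply: (@ResidueField F {fraction {poly F}} (@FracField.tofrac {poly F}) (@res F)).
- by move=> P Q /eqP; rewrite tofrac_eq => /eqP.
- exact: resE.
- exact: resD.
- exact: resZ.
Qed.

Section Residue.
Variables (F : fieldType) (K : residue_field F).
Local Notation emb := (rf_emb K).
Local Notation res := (@rf_res F K).
Local Notation "p %:F" := (emb p).
Implicit Types (P Q R : {poly F}) (x y : K) (c d : F).

Definition cst c : K := c%:P%:F.

Lemma cst_is_zmod_morphism : zmod_morphism cst.
Proof. by move=> a b; rewrite /cst polyCB rmorphB. Qed.
HB.instance Definition _ := GRing.isZmodMorphism.Build F K cst cst_is_zmod_morphism.
Lemma cst_is_monoid_morphism : monoid_morphism cst.
Proof. by split=> [|a b]; rewrite /cst ?polyC1 ?rmorph1 // polyCM rmorphM. Qed.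
HB.instance Definition _ := GRing.isMonoidMorphism.Build F K cst cst_is_monoid_morphism.

Lemma emb_eq0 P : (P%:F == 0) = (P == 0).
Proof. by rewrite -[X in _ == X](rmorph0 emb) (inj_eq (@rf_emb_inj F K)). Qed.

Lemma resZc c x : res (cst c * x) = c * res x.
Proof. exact: rf_resZ. Qed.

Lemma res0 : res 0 = 0.
Proof. by rewrite -(mul0r 0) -(rmorph0 cst) resZc mul0r. Qed.

Lemma resB x y : res (x - y) = res x - res y.
Proof.
have -> : x - y = x + cst (-1) * y by rewrite rmorphN rmorph1 mulN1r.
by rewrite rf_resD resZc mulN1r.
Qed.

Lemma res_sum (I : Type) (r : seq I) (p : pred I) (f : I -> K) :
  res (\sum_(i <- r | p i) f i) = \sum_(i <- r | p i) res (f i).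
Proof. exact: (big_morph res (@rf_resD F K) res0). Qed.

Lemma res_small P Q : (size P < (size Q).-1)%N -> res (P%:F / Q%:F) = 0.
Proof.
move=> s; have Q0 : Q != 0 by rewrite -size_poly_gt0; lia.
rewrite rf_resE // /res_poly modp_small ?nth_default ?mul0r //; move: (size P) (size Q) s => a b; lia.
Qed.

Definition Y : K := 'X%:F.

Lemma fracXsubC_neq0 c : Y - cst c != 0.
Proof. by rewrite /Y /cst -rmorphB emb_eq0 polyXsubC_eq0. Qed.

Lemma Y_neq0 : Y != 0.
Proof. by rewrite /Y emb_eq0 polyX_eq0. Qed.

(* Lagrange interpolation: the residue at infinity is the sum of the residues
   at the finite poles. *)
Lemma res_lagrange l (al : 'I_l -> F) P : injective al ->
  res (P%:F / \prod_i (Y - cst (al i))) =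
  \sum_i P.[al i] / \prod_(j | j != i) (al i - al j).
Proof.
move=> inj; pose Q := \prod_i ('X - (al i)%:P).
have -> : \prod_i (Y - cst (al i)) = Q%:F.
  by rewrite rmorph_prod; apply: eq_bigr => i _; rewrite rmorphB.
have sQ : size Q = l.+1 by rewrite size_prod_subC card_ord.
have Q0 : Q != 0 by rewrite -size_poly_gt0 sQ.
have Qr i : Q.[al i] = 0.
  by rewrite horner_prod (bigD1 i) //= hornerXsubC subrr mul0r.
pose D i := \prod_(j | j != i) (al i - al j).
have D0 i : D i != 0.
  by apply/prodf_neq0 => j ji; rewrite subr_eq0 (inj_eq inj) eq_sym.
rewrite rf_resE // /res_poly.
have -> : lead_coef Q = 1 by apply/eqP/monic_prod => i _; exact: monicXsubC.
rewrite divr1 sQ /=.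
pose L := \sum_i (P.[al i] / D i) *: \prod_(j | j != i) ('X - (al j)%:P).
have szL i : size (\prod_(j | j != i) ('X - (al j)%:P)) = l.
  by rewrite size_prod_subC cardC1 card_ord; case: (l) i => [[]|].
(* Both sides have degree below l and agree at the l distinct points [al i]. *)
suff -> : P %% Q = L.
  rewrite coef_sum; apply: eq_bigr => i _; rewrite coefZ.
  suff -> : (\prod_(j | j != i) ('X - (al j)%:P))`_l.-1 = 1 by rewrite mulr1.
  have : lead_coef (\prod_(j | j != i) ('X - (al j)%:P)) = 1.
    by apply/eqP/monic_prod => j _; exact: monicXsubC.
  by rewrite /lead_coef szL.
apply/eqP; rewrite -subr_eq0; apply/eqP.
apply: (@roots_geq_poly_eq0 _ _ [seq al i | i <- enum 'I_l]).
- apply/allP => _ /mapP[i _ ->]; rewrite rootE hornerD hornerN.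
  have -> : (P %% Q).[al i] = P.[al i].
    by rewrite {2}(divp_eq P Q) hornerD hornerM Qr mulr0 add0r.
  rewrite horner_sum (bigD1 i) //= [X in _ - (_ + X)]big1 => [|j ji].
    rewrite addr0 hornerZ horner_prod.
    under eq_bigr do rewrite hornerXsubC.
    by rewrite divfK ?subrr // D0.
  by rewrite hornerZ horner_prod (bigD1 i) 1?eq_sym //= hornerXsubC subrr mul0r mulr0.
- rewrite map_inj_uniq ?enum_uniq //.
- rewrite size_map size_enum_ord (leq_trans (size_polyD _ _)) // size_polyN geq_max.
  apply/andP; split; first by rewrite -ltnS -sQ ltn_modp.
  apply: (leq_trans (size_sum _ _ _)); apply/bigmax_leqP => i _.
  by rewrite (leq_trans (size_scale_leq _ _)) // szL.
Qed.

End Residue.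

(** * Vandermonde products when one variable changes *)

Section Vand.
Variables (F : fieldType) (l : nat).
Implicit Types (v w : 'I_l -> F) (k : 'I_l) (c : F).

Definition vand v : F := \prod_(i < l) \prod_(j < l | (i < j)%N) (v i - v j).

Definition lower v k c : 'I_l -> F := fun i => if i == k then v i - c else v i.

Lemma vand_perm v (s : 'S_l) : vand (v \o s) = (-1) ^+ s * vand v.
Proof.
have vandE w : vand w = \det (Vandermonde l (\row_j - w j)).
  rewrite det_Vandermonde; apply: eq_bigr => i _; apply: eq_bigr => j _.
  by rewrite !mxE; ring.
rewrite !vandE -odd_permV -det_perm mulrC -det_mulmx.
congr (\det _); rewrite -col_permE.
by apply/matrixP=> i j; rewrite !mxE /=.
Qed.

Lemma vand_eq0 v i j : i != j -> v i = v j -> vand v = 0.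
Proof.
wlog ij : i j / (i < j)%N => [hw ne e|_ e].
  move: (ne); rewrite neq_ltn => /orP[]; first by move/hw; apply.
  by move/hw; apply=> //; rewrite eq_sym.
by rewrite /vand (bigD1 i) //= (bigD1 j) //= e subrr !mul0r.
Qed.

Lemma vand_neq0 v : injective v -> vand v != 0.
Proof.
move=> inj; apply/prodf_neq0 => i _; apply/prodf_neq0 => j ij.
by rewrite subr_eq0 (inj_eq inj) -val_eqE neq_ltn ij.
Qed.

Lemma prod_pairsD1 (G : 'I_l -> 'I_l -> F) k :
  \prod_(i < l) \prod_(j < l | (i < j)%N) G i j =
  (\prod_(j < l | (k < j)%N) G k j) * (\prod_(i < l | (i < k)%N) G i k) *
  \prod_(i < l | i != k) \prod_(j < l | (i < j)%N && (j != k)) G i j.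
Proof.
rewrite (bigD1 k) //= -mulrA; congr (_ * _).
rewrite [X in _ = X * _]big_mkcond [X in _ = X * _](bigD1 k) //= ltnn mul1r -big_split /=.
apply: eq_bigr => i ik; case: ifP => lt; first by rewrite (bigD1 k).
by rewrite mul1r; apply: eq_bigl => j; case: eqP => [->|]; rewrite ?lt ?andbT.
Qed.

(** The factors of [vand u] involving k are the product of u k - u j over j != k, up to a sign
    depending on k only; the other factors do not see k. The identity is cross-multiplied because
    either product may vanish. *)
Lemma vand_upd v w k : (forall j, j != k -> v j = w j) ->
  vand v * \prod_(j | j != k) (w k - w j) = vand w * \prod_(j | j != k) (v k - v j).
Proof.
move=> e.
pose rest (u : 'I_l -> F) := \prod_(i < l | i != k) \prod_(j < l | (i < j)%N && (j != k)) (u i - u j).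
have restE : rest v = rest w.
  by apply: eq_bigr => i ik; apply: eq_bigr => j /andP[_ jk]; rewrite !e.
have vE u : vand u = (-1) ^+ #|[pred i : 'I_l | (i < k)%N]| *
    (\prod_(j | j != k) (u k - u j)) * rest u.
  rewrite /vand (prod_pairsD1 _ k) -/(rest u); congr (_ * _).
  have -> : \prod_(i < l | (i < k)%N) (u i - u k) =
      (-1) ^+ #|[pred i : 'I_l | (i < k)%N]| * \prod_(i < l | (i < k)%N) (u k - u i).
    by rewrite -prodrN; apply: eq_bigr => i _; rewrite opprB.
  rewrite [\prod_(j | j != k) _](bigID (fun j : 'I_l => (k < j)%N)) /=.
  rewrite mulrCA; congr (_ * (_ * _)).
    by apply: eq_bigl => j; rewrite -val_eqE /=; case: (ssrnat.ltngtP k j).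
  by apply: eq_bigl => j; rewrite -val_eqE /=; case: (ssrnat.ltngtP k j).
by rewrite !vE restE; ring.
Qed.

End Vand.

(** * Frobenius' rational function and its moments *)

Section Tau.
Variables (F : fieldType) (K : residue_field F).
Local Notation emb := (rf_emb K).
Local Notation res := (@rf_res F K).
Local Notation "p %:F" := (emb p).
Local Notation cst := (@cst F K).
Local Notation Y := (@Y F K).
Variable l : nat.
Implicit Types (al : 'I_l -> F) (k : 'I_l) (r : nat) (m : int).

Definition ffactr (R : pzRingType) (x : R) r : R := \prod_(j < r) (x - j%:R).

Definition num_poly al r : {poly F} :=
  ffactr ('X + (l%:R - 1)) r * \prod_i ('X - (r%:R + al i)%:P).
Definition den_poly al : {poly F} := \prod_i ('X - (al i)%:P).

(** For exponents beta_i = al i + l - 1 this is Frobenius' function for an r-cycle, (y + l - 1)_r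
    prod_i (y - r - al i) / (y - al i). For distinct al, its residue at al k is -r (beta_k)_r times
    the ratio of the Vandermonde products after and before lowering al k by r. *)
Definition Phi al r : K := (num_poly al r)%:F / (den_poly al)%:F.

(* The coefficient of y^(-m-1) in the expansion of - Phi al r / r at infinity. *)
Definition tau al r m : F := - r%:R^-1 * res (Phi al r * Y ^ m).

Lemma size_num_poly al r : size (num_poly al r) = (r + l).+1.
Proof.
rewrite /num_poly /ffactr.
have -> : \prod_(j < r) ('X + (l%:R - 1) - j%:R) =
   \prod_(j < r) ('X - (1 - l%:R + j%:R)%:P) :> {poly F}.
  by apply: eq_bigr => j _; rewrite !(polyCD, polyCN) !polyC_natr; ring.
rewrite size_mul ?size_prod_subC ?card_ord -?size_poly_gt0 ?size_prod_subC //.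
by rewrite addSn addnS.
Qed.

Lemma size_den_poly al : size (den_poly al) = l.+1.
Proof. by rewrite size_prod_subC card_ord. Qed.

Lemma den_poly_neq0 al : den_poly al != 0.
Proof. by rewrite -size_poly_gt0 size_den_poly. Qed.

Lemma den_polyE al : (den_poly al)%:F = \prod_i (Y - cst (al i)).
Proof. by rewrite rmorph_prod; apply: eq_bigr => i _; rewrite rmorphB. Qed.

Lemma YXn n : 'X^n%:F = Y ^+ n.
Proof. by rewrite rmorphXn. Qed.

(** [Phi al r] has degree r in y, so the product has degree r - e - d, at most -2. The case d = 1
    serves the remainder of a truncated geometric series. *)
Lemma res_Phi_small al r (c : F) e (d : nat) : (d <= 1)%N -> (r + 1 < e + d)%N ->
  res (Phi al r * Y ^- e / (Y - cst c) ^+ d) = 0.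
Proof.
move=> d1 re; rewrite /Phi -YXn -rmorphB -rmorphXn -!mulrA -!invfM -!rmorphM.
apply: res_small; rewrite size_num_poly.
have s0 (P Q : {poly F}) : P != 0 -> Q != 0 -> size (P * Q) = (size P + size Q).-1.
  by move=> *; rewrite size_mul.
rewrite !s0 ?mulf_neq0 ?expf_neq0 ?polyXsubC_eq0 ?polyX_eq0 ?den_poly_neq0 //.
rewrite size_den_poly size_polyXn.
case: d d1 re => [|[|//]] _ re; rewrite ?expr0 ?expr1 ?size_XsubC ?size_poly1; lia.
Qed.

Lemma tau_small al r m : (m < - (r.+1)%:Z)%R -> tau al r m = 0.
Proof.
case: m => e; first lia.
move=> re; rewrite /tau NegzE -exprnN.
have := @res_Phi_small al r 0 e.+1 0 isT; rewrite expr0 divr1 => -> //; rewrite ?mulr0 //.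
lia.
Qed.

Lemma vand_moment_inj al r (m : nat) : r%:R != 0 :> F -> injective al ->
  \sum_k ffactr (al k + (l%:R - 1)) r * vand (lower al k r%:R) * al k ^+ m =
  vand al * tau al r m.
Proof.
move=> r0 inj; rewrite /tau /Phi -exprnP -YXn mulrAC -rmorphM den_polyE res_lagrange //.
rewrite mulr_sumr mulr_sumr; apply: eq_bigr => k _.
have D0 : \prod_(j | j != k) (al k - al j) != 0.
  by apply/prodf_neq0 => j jk; rewrite subr_eq0 (inj_eq inj) eq_sym.
have e := @vand_upd F l (lower al k r%:R) al k _.
rewrite -[vand (lower _ _ _)](mulfK D0) e => [|j jk]; last by rewrite /lower (negPf jk).
rewrite hornerM hornerXn hornerM.
have -> : (ffactr ('X + (l%:R - 1)) r).[al k] = ffactr (al k + (l%:R - 1)) r.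
  rewrite horner_prod; apply: eq_bigr => j _.
  by rewrite -!polyC_natr -polyC1 !hornerE.
(* The factor i = k is -r; the factor -1/r in [tau] cancels it. *)
have -> : (\prod_i ('X - (r%:R + al i)%:P)).[al k] =
    - r%:R * \prod_(j < l | j != k) (lower al k r%:R k - lower al k r%:R j).
  rewrite horner_prod (bigD1 k) //= hornerXsubC; congr (_ * _); first by ring.
  apply: eq_bigr => j jk; rewrite hornerXsubC /lower eqxx (negPf jk); ring.
by field; rewrite D0 r0.
Qed.

(* Without repetitions in al this is the residue theorem; otherwise both sides
   vanish, since vand is alternating. *)
Lemma vand_moment al r (m : nat) : r%:R != 0 :> F ->
  \sum_k ffactr (al k + (l%:R - 1)) r * vand (lower al k r%:R) * al k ^+ m =
  vand al * tau al r m.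
Proof.
move=> r0; have [/injectiveP inj|] := boolP (injectiveb al).
  exact: vand_moment_inj.
move=> /injectivePn[i [j ij e]].
(* Lowering [al i] or [al j] gives the same vector up to a transposition, so these two terms cancel;
   every other term keeps the repetition. *)
rewrite (vand_eq0 ij e) mul0r (bigD1 i) //= (bigD1 j) 1?eq_sym //= big1 => [|k /andP[ki kj]].
  have -> : lower al j r%:R = lower al i r%:R \o tperm i j.
    apply: funext => k /=; rewrite /lower; case: tpermP => [->|->|].
    - by rewrite (negPf ij) eq_sym (negPf ij) e.
    - by rewrite !eqxx e.
    - by move=> /eqP /negPf -> /eqP /negPf ->.
  by rewrite vand_perm odd_tperm ij e; ring.
rewrite (@vand_eq0 _ _ (lower al k r%:R) i j ij) ?mulr0 ?mul0r //.
by rewrite /lower eq_sym (negPf ki) eq_sym (negPf kj).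
Qed.

End Tau.

Section TauShift.
Variables (F : fieldType) (K : residue_field F).
Local Notation emb := (rf_emb K).
Local Notation res := (@rf_res F K).
Local Notation "p %:F" := (emb p).
Local Notation cst := (@cst F K).
Local Notation Y := (@Y F K).
Local Notation Phi := (@Phi F K _).
Local Notation tau := (@tau F K _).
Variable l : nat.
Implicit Types (al : 'I_l -> F) (k : 'I_l) (r : nat) (m : int).

Lemma inv_subC_geometric (c : F) N :
  (Y - cst c)^-1 = \sum_(j < N) cst (c ^+ j) * Y ^- j.+1
                   + cst (c ^+ N) * (Y ^- N / (Y - cst c)).
Proof.
have Y0 := Y_neq0 K; have Yc := fracXsubC_neq0 K c.
elim: N => [|N IH]; first by rewrite big_ord0 add0r !expr0 rmorph1 invr1 !mul1r.
rewrite {1}IH big_ord_recr /= -addrA; congr (_ + _).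
have e : Y ^- N / (Y - cst c) = Y ^- N.+1 + cst c * Y ^- N.+1 / (Y - cst c).
  rewrite exprS invfM; set t := Y ^- N; by field; rewrite Y0 Yc.
by rewrite e [c ^+ N.+1]exprSr rmorphM; ring.
Qed.

Lemma PhiE al r : Phi al r = ffactr (Y + (l%:R - 1)) r *
  \prod_i ((Y - r%:R - cst (al i)) / (Y - cst (al i))).
Proof.
rewrite /Phi den_polyE /num_poly. rewrite rmorphM big_split /= prodfV mulrA; congr (_ * _ / _).
  rewrite rmorph_prod; apply: eq_bigr => j _.
  by rewrite rmorphB rmorphD rmorphB !rmorph_nat rmorph1.
rewrite rmorph_prod; apply: eq_bigr => i _.
by rewrite rmorphB polyCD rmorphD polyC_natr rmorph_nat opprD addrA.
Qed.

Lemma Phi_lower al k r r' :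
  Phi (lower al k r'%:R) r = Phi al r +
    Phi al r * (cst (r%:R * r'%:R) / ((Y - cst (al k - r'%:R)) * (Y - cst (al k + r%:R)))).
Proof.
rewrite !PhiE.
under eq_bigr => i _ do rewrite /lower.
rewrite (bigD1 k) //= eqxx [X in _ + _ * X * _](bigD1 k) //= [X in _ = _ * X + _](bigD1 k) //=.
rewrite (eq_bigr (fun i => (Y - r%:R - cst (al i)) / (Y - cst (al i)))); last first.
  by move=> i /negPf ->.
set P := \prod_(i < l | i != k) _; set f := ffactr _ _.
have := fracXsubC_neq0 K (al k); have := fracXsubC_neq0 K (al k - r'%:R).
have := fracXsubC_neq0 K (al k + r%:R).
rewrite rmorphM rmorphB rmorphD !rmorph_nat => h1 h2 h3.
by field; rewrite h1 h2 h3.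
Qed.

(** The binomial formula, with y^(b+1) - (-x)^(b+1) written as y^(b+1) + x (-x)^b: this is the
    numerator in the pair factor of A. Any B > a will do, since the binomial coefficient vanishes
    for b > a, where a - b is truncated. *)
Lemma diff_powers (R : comNzRingType) (z x y : R) a B : (a < B)%N ->
  (z + y) ^+ a.+1 - (z - x) ^+ a.+1 =
  \sum_(b < B) 'C(a.+1, b.+1)%:R * (x * (- x) ^+ b + y ^+ b.+1) * z ^+ (a - b).
Proof.
move=> aB.
rewrite !exprDn big_ord_recl [X in _ - X]big_ord_recl /= !subn0 !expr0 opprD addrACA subrr add0r. rewrite -sumrB.
pose f b := 'C(a.+1, b.+1)%:R * (x * (- x) ^+ b + y ^+ b.+1) * z ^+ (a - b).
rewrite -[RHS]/(\sum_(b < B) f b).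
have -> : \sum_(b < B) f b = \sum_(b < B | (b < a.+1)%N) f b.
  rewrite [RHS]big_mkcond; apply: eq_bigr => b _; case: ltnP => // ab.
  by rewrite /f bin_small ?mul0r.
rewrite -(big_ord_widen B f aB); apply: eq_bigr => b _.
have -> : bump 0 b = b.+1 by [].
rewrite /f subSS -mulrnBl -[LHS]mulr_natl [(- x) ^+ b.+1]exprS.
move: ('C(_, _)%:R : R) ((- x) ^+ b) (y ^+ b.+1) (z ^+ _) => C p q t; ring.
Qed.

(* Removing r' from al k multiplies Phi al r by 1 + r r' / ((u + r') (u - r)) with
   u = y - al k; the double sum comes from expanding this factor at infinity. *)
Lemma tau_lower al k r r' m B : r%:R != 0 :> F -> (r + r')%:R != 0 :> F ->
  (r%:Z + m <= B%:Z)%R ->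
  tau (lower al k r'%:R) r m = tau al r m +
  (r' * r)%:R * \sum_(a < B) \sum_(b < B)
    'C(a.+1, b.+1)%:R * ((r'%:R * (- r'%:R) ^+ b + r%:R ^+ b.+1) / (r'%:R + r%:R)) *
    al k ^+ (a - b) * tau al r (m - a%:Z - 2%:Z).
Proof.
move=> r0 rr0 mB; set z := al k; set x : F := r'%:R; set y : F := r%:R.
have xy0 : x + y != 0 by rewrite -natrD addnC.
have Y0 : Y != 0 := Y_neq0 K.
rewrite /tau Phi_lower mulrDl rf_resD mulrDr; congr (_ + _).
pose rem (c : F) := cst (c ^+ B.+1) * (Y ^- B.+1 / (Y - cst c)).
(* Partial fractions with denominators u - r and u + r', each expanded geometrically. The terms in
   1/Y cancel, so the series starts at Y^-2: hence the value 2 of eps. *)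
have -> : Phi al r * (cst (y * x) / ((Y - cst (z - x)) * (Y - cst (z + y)))) * Y ^ m =
  cst (y * x / (x + y)) * (\sum_(a < B) cst ((z + y) ^+ a.+1 - (z - x) ^+ a.+1) *
        (Phi al r * Y ^ (m - a%:Z - 2%:Z))
    + Phi al r * Y ^ m * rem (z + y) - Phi al r * Y ^ m * rem (z - x)).
  have h1 := fracXsubC_neq0 K (z + y); have h2 := fracXsubC_neq0 K (z - x).
  have h3 : cst (x + y) != 0 by rewrite fmorph_eq0.
  have -> : cst (y * x) / ((Y - cst (z - x)) * (Y - cst (z + y))) =
      cst (y * x / (x + y)) * ((Y - cst (z + y))^-1 - (Y - cst (z - x))^-1).
    have -> : cst (y * x / (x + y)) = cst (y * x) / cst (x + y).
      by rewrite [LHS]rmorphM fmorphV.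
    have e : cst (x + y) = (Y - cst (z - x)) - (Y - cst (z + y)).
      by rewrite !rmorphD rmorphN; ring.
    move: h1 h2 h3; rewrite e; move: (cst (y * x)) (Y - _) (Y - _) => c a b b0 a0 ab0.
    by field; rewrite b0 a0 ab0.
  have geo c : (Y - cst c)^-1 =
      Y^-1 + \sum_(i < B) cst (c ^+ i.+1) * Y ^- i.+2 + rem c.
    rewrite {1}(inv_subC_geometric c B.+1) big_ord_recl expr0 rmorph1 mul1r expr1.
    by congr (_ + _ + _); apply: eq_bigr => i _.
  rewrite (geo (z + y)) (geo (z - x)).
  rewrite [Phi al r * (_ * _)]mulrCA -[LHS]mulrA; congr (_ * _).
  have -> : \sum_(a < B) cst ((z + y) ^+ a.+1 - (z - x) ^+ a.+1) * (Phi al r * Y ^ (m - a%:Z - 2%:Z))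
     = Phi al r * Y ^ m * (\sum_(i < B) cst ((z + y) ^+ i.+1) * Y ^- i.+2
         - \sum_(i < B) cst ((z - x) ^+ i.+1) * Y ^- i.+2).
    rewrite -sumrB mulr_sumr; apply: eq_bigr => a _.
    have -> : Y ^ (m - a%:Z - 2%:Z) = Y ^ m * Y ^- a.+2.
      by rewrite exprnN -expfzDr //; congr (_ ^ _); lia.
    rewrite rmorphB; ring.
  ring.
rewrite resZc resB rf_resD.
(* By r + m <= B, this function has degree at most -2 at infinity. *)
have remE c : res (Phi al r * Y ^ m * rem c) = 0.
  rewrite /rem mulrCA resZc.
  have -> : Phi al r * Y ^ m * (Y ^- B.+1 / (Y - cst c)) =
     Phi al r * Y ^- `|B.+1%:Z - m|%N / (Y - cst c) ^+ 1.
    have <- : Y ^ m * Y ^- B.+1 = Y ^- `|B.+1%:Z - m|%N.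
      rewrite !exprnN -expfzDr //; congr (_ ^ _); lia.
    by rewrite expr1; ring.
  rewrite res_Phi_small ?mulr0 //; lia.
rewrite !remE subr0 addr0 res_sum.
rewrite !mulr_sumr; apply: eq_bigr => a _; rewrite resZc.
rewrite (@diff_powers _ z x y a B) // natrM -/x -/y.
rewrite mulr_suml !mulr_sumr; apply: eq_bigr => b _.
field; rewrite ?xy0 ?r0 //.
Qed.

End TauShift.

(** * Moments in terms of the contents of la *)

Section TauContents.
Variables (F : fieldType) (K : residue_field F).
Local Notation emb := (rf_emb K).
Local Notation res := (@rf_res F K).
Local Notation "p %:F" := (emb p).
Local Notation cst := (@cst F K).
Local Notation Y := (@Y F K).
Local Notation tau := (@tau F K _).
Variable la : seq nat.
Local Notation l := (size la).

(** The content of the first cell past the end of row i; adding l - 1 gives the exponent of la +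
    delta. *)
Definition content_ends (i : 'I_l) : F := (nth 0%N la i)%:R - i%:R.

(** Multiplication by y moves the coefficient of y^-1 to the constant term of the polynomial part,
    which ties residues to [desc_coef]. *)
Lemma res_polyX (P Q : {poly F}) : Q != 0 -> ((P * 'X) %/ Q)`_0 = res_poly P Q.
Proof.
move=> Q0; have sQ : (0 < size Q)%N by rewrite size_poly_gt0.
have sB : (size (P %% Q)%R < size Q)%N by rewrite ltn_modp.
set B := P %% Q in sB *; set c := res_poly P Q.
have e : P * 'X = (P %/ Q * 'X + c%:P) * Q + (B * 'X - c%:P * Q).
  rewrite {1}(divp_eq P Q) -/B; ring.
rewrite e divp_addl_mul_small; first by rewrite coefD coefMX coefC /= add0r.
have sz : (size (B * 'X - c%:P * Q)%R <= size Q)%N.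
  rewrite (leq_trans (size_polyD _ _)) // size_polyN geq_max mul_polyC size_scale_leq andbT.
  by rewrite (leq_trans (size_polyMleq _ _)) // size_polyX addn2.
rewrite ltn_neqAle sz andbT; apply/negP => /eqP eq.
have : lead_coef (B * 'X - c%:P * Q) = 0.
  rewrite /lead_coef eq coefB coefMX mul_polyC coefZ /c /res_poly -/B.
  have lQ : lead_coef Q != 0 by rewrite lead_coef_eq0.
  have -> : Q`_(size Q).-1 = lead_coef Q by [].
  rewrite divfK //; case: eqP => [e0|_]; last by rewrite subrr.
  have -> : B = 0 by apply/eqP; rewrite -size_poly_eq0; move: sB e0 sQ; case: (size Q) => [|[|]] //; case: (size B).
  by rewrite coef0 subrr.
by move/eqP; rewrite lead_coef_eq0 -size_poly_eq0 eq size_poly_eq0 (negPf Q0).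
Qed.

Lemma res_desc_coef (P Q : {poly F}) j : Q != 0 ->
  res (P%:F / Q%:F * Y ^ (j%:Z - 1)) = desc_coef P Q j.
Proof.
move=> Q0; have Y0 : Y != 0 := Y_neq0 K.
have QX0 : Q * 'X != 0 by rewrite mulf_neq0 ?polyX_eq0.
have -> : P%:F / Q%:F * Y ^ (j%:Z - 1) = (P * 'X^j)%:F / (Q * 'X)%:F.
  rewrite expfzDr // -exprnP exprN1 !rmorphM rmorphXn invfM; ring.
rewrite rf_resE // -res_polyX // /desc_coef.
congr (_ `_ 0).
have {1}-> : P * 'X^j * 'X = (P * 'X^j) %/ Q * (Q * 'X) + (P * 'X^j) %% Q * 'X.
  by rewrite {1}(divp_eq (P * 'X^j) Q); ring.
rewrite divp_addl_mul_small //.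
rewrite [X in (_ < X)%N]size_mulX //.
have sm : (size ((P * 'X^j) %% Q)%R < size Q)%N by rewrite ltn_modp.
by rewrite ltnS (leq_trans (size_polyMleq _ _)) // size_polyX addn2.
Qed.

Lemma size_comp_subX (P : {poly F}) (a : F) : size (P \Po (a%:P - 'X)) = size P.
Proof. by rewrite size_comp_poly2 // -opprB size_polyN size_XsubC. Qed.

Lemma content_poly_neq0 : content_poly F la != 0.
Proof.
apply/prodf_neq0 => i _; apply/prodf_neq0 => j _.
by rewrite -size_poly_gt0 size_XaddC.
Qed.

Lemma content_poly_comp (a : F) :
  (content_poly F la \Po (a%:P - 'X))%:F =
  \prod_(i < l) \prod_(j < nth 0%N la i) (cst a - Y + j%:R - i%:R).
Proof.
rewrite /content_poly rmorph_prod rmorph_prod; apply: eq_bigr => i _.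
rewrite !rmorph_prod; apply: eq_bigr => j _.
rewrite /= comp_polyD comp_polyX comp_polyC intrB -!pmulrn polyCB !polyC_natr.
by rewrite rmorphD !rmorphB !rmorph_nat addrA.
Qed.

Lemma telescope_prod_div (R : fieldType) (f : nat -> R) n :
  (forall j, f j != 0) -> \prod_(j < n) (f j.+1 / f j) = f n / f 0%N.
Proof.
move=> f0; elim: n => [|n IH]; first by rewrite big_ord0 divff.
rewrite big_ord_recr IH /=; field; rewrite !f0 //.
Qed.

Lemma ffactrS (R : comNzRingType) (x : R) r : ffactr x r.+1 = x * ffactr (x - 1) r.
Proof.
rewrite /ffactr big_ord_recl subr0; congr (_ * _); apply: eq_bigr => j _.
by rewrite lift0 -addn1 natrD; ring.
Qed.

Lemma ffactrSr (R : comNzRingType) (x : R) r : ffactr x r.+1 = ffactr x r * (x - r%:R).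
Proof. by rewrite /ffactr big_ord_recr. Qed.

(** Both sides are the falling factorial (x + n - 1)_(n + r), cut after n factors or after r
    factors. *)
Lemma ffactr_shift (R : comNzRingType) (x : R) n r :
  (\prod_(i < n) (x + i%:R)) * ffactr (x - 1) r =
  ffactr (x + (n%:R - 1)) r * \prod_(i < n) (x - r%:R + i%:R).
Proof.
elim: n => [|n IH]; first by rewrite !big_ord0 mul1r mulr1 sub0r.
rewrite !big_ord_recr /= mulrAC IH.
have -> : x + (n.+1%:R - 1) = x + n%:R by rewrite -addn1 natrD; ring.
have := ffactrS (x + n%:R) r; rewrite ffactrSr.
have -> : x + n%:R - 1 = x + (n%:R - 1) by ring.
have -> : x + n%:R - r%:R = x - r%:R + n%:R by ring.
move: (ffactr _ _) (ffactr _ _) (\prod_(i < n) _) => a b p.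
by move=> e; transitivity (p * (b * (x - r%:R + n%:R))); [rewrite e | ]; ring.
Qed.

Lemma stirling1_ffactr (R : comNzRingType) (x : R) r :
  ffactr x r = \sum_(t < r.+1) (stirling1 r t)%:~R * x ^+ t.
Proof.
pose P : {poly int} := \prod_(j < r) ('X - (j%:R : int)%:P).
have sP : size P = r.+1.
  by rewrite size_prod_subC card_ord.
have -> : ffactr x r = (map_poly intr P).[x].
  rewrite rmorph_prod horner_prod; apply: eq_bigr => j _.
  by rewrite rmorphB /= map_polyX map_polyC /= hornerXsubC rmorph_nat.
rewrite (@horner_coef_wide _ r.+1); last by rewrite (leq_trans (size_poly _ _)) ?sP.
by apply: eq_bigr => t _; rewrite coef_map.
Qed.

Lemma stirling1_eq0 r (t : int) : (t < 0) || (r%:Z < t)%R -> stirling1 r t = 0.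
Proof.
case: t => //= t rt; apply: nth_default.
by rewrite size_prod_subC card_ord; lia.
Qed.

Section Expansion.
Variable r : nat.
Hypothesis r0 : r%:R != 0 :> F.
Let x : F := r%:R.
Let C := content_poly F la.
Let P : {poly F} := (C \Po ((x + 1)%:P - 'X)) * (C \Po (- 'X)).
Let Q : {poly F} := (C \Po (x%:P - 'X)) * (C \Po (1 - 'X)).

Let QE : Q = (C \Po (x%:P - 'X)) * (C \Po (1%:P - 'X)). Proof. by []. Qed.
Let PE : P = (C \Po ((x + 1)%:P - 'X)) * (C \Po (0%:P - 'X)).
Proof. by rewrite /P polyC0 sub0r. Qed.

Let comp_neq0 (a : F) : C \Po (a%:P - 'X) != 0.
Proof. by rewrite -size_poly_gt0 size_comp_subX size_poly_gt0 content_poly_neq0. Qed.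

Let Q0 : Q != 0. Proof. by rewrite QE mulf_neq0 ?comp_neq0. Qed.

Let sPQ : size P = size Q.
Proof.
by rewrite QE PE [LHS]size_mul ?comp_neq0 // [RHS]size_mul ?comp_neq0 // !size_comp_subX.
Qed.

(** Contents increase by 1 along a row, so the cell factors telescope to the ends of the row; Y + i
    and Y - r + i come from the first column. *)
Lemma content_ratioE : P%:F / Q%:F =
  \prod_(i < l) (((Y - r%:R - cst (content_ends i)) / (Y - cst (content_ends i))) *
                 ((Y + i%:R) / (Y - r%:R + i%:R))).
Proof.
rewrite QE PE !rmorphM !content_poly_comp.
rewrite -!big_split /= -prodf_div; apply: eq_bigr => i _.
have nz (c : F) : cst c - Y != 0 by rewrite -opprB oppr_eq0 fracXsubC_neq0.
rewrite -!big_split /= -prodf_div.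
pose f j := cst x - Y + j%:R - i%:R; pose g j := cst 0 - Y + j%:R - i%:R.
have fE j : f j = cst (x + j%:R - i%:R) - Y.
  by rewrite /f rmorphB rmorphD !rmorph_nat; ring.
have gE j : g j = cst (j%:R - i%:R) - Y.
  by rewrite /g rmorphB !rmorph_nat rmorph0; ring.
have f0 j : f j != 0 by rewrite fE nz.
have g0 j : g j != 0 by rewrite gE nz.
have -> : \prod_(j < nth 0%N la i)
   ((cst (x + 1) - Y + j%:R - i%:R) * (cst 0 - Y + j%:R - i%:R) /
    ((cst x - Y + j%:R - i%:R) * (cst 1 - Y + j%:R - i%:R))) =
   \prod_(j < nth 0%N la i) (f j.+1 / f j) / \prod_(j < nth 0%N la i) (g j.+1 / g j).
  rewrite -prodf_div; apply: eq_bigr => j _.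
  have -> : cst (x + 1) - Y + j%:R - i%:R = f j.+1.
    by rewrite /f rmorphD rmorph1 -[j.+1]addn1 natrD; ring.
  have -> : cst 1 - Y + j%:R - i%:R = g j.+1.
    by rewrite /g rmorph1 rmorph0 -[j.+1]addn1 natrD; ring.
  by rewrite -/(f j) -/(g j); field; rewrite !f0 !g0.
rewrite !telescope_prod_div // /content_ends.
have -> : Y - r%:R - cst ((nth 0%N la i)%:R - i%:R) = - f (nth 0%N la i).
  by rewrite fE /x !(rmorphD, rmorphN, rmorph_nat); ring.
have -> : Y - cst ((nth 0%N la i)%:R - i%:R) = - g (nth 0%N la i).
  by rewrite gE; ring.
have -> : Y + i%:R = - g 0%N by rewrite gE sub0r rmorphN rmorph_nat; ring.
have -> : Y - r%:R + i%:R = - f 0%N.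
  by rewrite fE addr0 /x !(rmorphD, rmorphN, rmorph_nat); ring.
by field; rewrite !oppr_eq0 !f0 !g0.
Qed.

(** By [ffactr_shift] the first-column factors turn (y + l - 1)_r into (y - 1)_r, which no longer
    involves the number of rows. *)
Lemma Phi_contents : Phi K content_ends r = ffactr (Y - 1) r * (P%:F / Q%:F).
Proof.
rewrite PhiE content_ratioE [X in _ = _ * X]big_split /= [X in _ = _ * (_ * X)]prodf_div.
have nz : \prod_(i < l) (Y - r%:R + i%:R) != 0.
  apply/prodf_neq0 => i _.
  have -> : Y - r%:R + i%:R = Y - cst (r%:R - i%:R).
    by rewrite rmorphB !rmorph_nat; ring.
  exact: fracXsubC_neq0.
have e := ffactr_shift Y l r.
by apply: (mulIf nz); rewrite mulrAC -e; field.
Qed.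

(** As (y - 1)_r = (y)_(r+1) / y, the falling factorial expands with the coefficients s(r + 1, t),
    and the term y^(t+m) selects the coefficient c of index i = t + m. The bound on N comes from t
    <= r + 1. *)
Lemma tau_contents (m : int) N : (r.+1%:Z + m < N%:Z)%R ->
  tau content_ends r m =
  \sum_(i < N) (stirling1 r.+1 (i%:Z - m))%:~R * c_coef la x i.
Proof.
move=> mN; have Y0 : Y != 0 := Y_neq0 K.
pose D (j : int) := res (P%:F / Q%:F * Y ^ (j - 1)).
(* P and Q have the same degree, so P / Q has no positive power of y. *)
have D_lt0 j : (j < 0)%R -> D j = 0.
  case: j => // j _; rewrite /D NegzE.
  have -> : P%:F / Q%:F * Y ^ (- j.+1%:Z - 1) = P%:F / (Q * 'X^(j.+2))%:F.
    have -> : (- j.+1%:Z - 1 = - j.+2%:Z)%R by lia.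
    rewrite -exprnN [(Q * _)%:F]rmorphM YXn. by move: (P%:F) (Q%:F) (Y ^+ _) => p q y; rewrite invfM mulrA.
  apply: res_small; rewrite [size (Q * _)]size_mul ?expf_neq0 ?polyX_eq0 //.
  rewrite size_polyXn sPQ.
  have : (0 < size Q)%N by rewrite size_poly_gt0.
  by case: (size Q) => // s _; rewrite !addSn /= !addnS ltnS leq_addr.
have D_nat j : c_coef la x j = - x^-1 * D j%:Z by rewrite /D res_desc_coef.
have -> : tau content_ends r m =
    - x^-1 * \sum_(t < r.+2) (stirling1 r.+1 t)%:~R * D (t%:Z + m).
  rewrite /tau Phi_contents; congr (_ * _).
  have -> : ffactr (Y - 1) r = Y^-1 * ffactr Y r.+1 by rewrite ffactrS mulKf.
  rewrite stirling1_ffactr mulr_sumr !mulr_suml res_sum; apply: eq_bigr => t _.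
  rewrite -resZc rmorph_int; congr res.
  have -> : Y ^ (t%:Z + m - 1) = Y ^+ t * Y ^ m * Y^-1 by rewrite !expfzDr // exprN1.
  ring.
rewrite mulr_sumr.
pose G (t i : nat) : F := if (i%:Z == t%:Z + m) then
   (stirling1 r.+1 t)%:~R * (- x^-1 * D i%:Z) else 0.
transitivity (\sum_(t < r.+2) \sum_(i < N) G t i).
  apply: eq_bigr => t _.
  case E: (t%:Z + m) => [i|i].
    have iN : (i < N)%N by move: (ltn_ord t); lia.
    rewrite (bigD1 (Ordinal iN)) // /G E eqxx [X in _ = _ + X]big1 ?addr0; first by ring.
    move=> j; rewrite -val_eqE /= => /negPf ji.
    by rewrite eqz_nat ji.
  rewrite D_lt0 ?mulr0 //.
  by rewrite big1 // => j _; rewrite /G E.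
rewrite exchange_big; apply: eq_bigr => i _ /=.
case E: (i%:Z - m) => [t|t]; last first.
  rewrite mul0r big1 // => t' _; rewrite /G; case: eqP => // e; exfalso.
  move: E e; lia.
case: (ltnP t r.+2) => tr.
  rewrite (bigD1 (Ordinal tr)) // /G [X in _ + X = _]big1 ?addr0.
    have -> : (i%:Z == t%:Z + m) by rewrite -E subrK.
    by rewrite D_nat.
  move=> j; rewrite -val_eqE /= => ji; case: eqP => // e; exfalso.
  by move/eqP: ji; apply; move: E e; lia.
rewrite stirling1_eq0 ?mul0r; last by apply/orP; right; lia.
rewrite big1 // => j _; rewrite /G; case: eqP => // e; exfalso.
by move: (ltn_ord j) E e tr; lia.
Qed.

End Expansion.

End TauContents.

(** * Expansion over tables of exponents *)

(* Summing the k-th inequality with weight k + 1. *)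
Lemma weighted_bound r (a b e : 'I_r -> 'I_r -> nat) (c i : 'I_r -> nat) :
  (forall k, (i k + \sum_(l < r | (l < k)%N) (a l k + e l k) <=
     c k + \sum_(q < r | (k < q)%N) (a k q - b k q))%N) ->
  (\sum_k i k + \sum_(l < r) \sum_(k < r | (l < k)%N) a l k <= \sum_(k < r) k.+1 * c k)%N.
Proof.
move=> h.
have : (\sum_(k < r) (k.+1 * i k + k.+1 * \sum_(l < r | (l < k)%N) a l k) <=
    \sum_(k < r) (k.+1 * c k + k.+1 * \sum_(q < r | (k < q)%N) a k q))%N.
  apply: leq_sum => k _; rewrite -!mulnDr leq_mul2l /=; apply: leq_trans (leq_trans (h k) _).
    by rewrite leq_add2l; apply: leq_sum => l _; exact: leq_addr.
  by rewrite leq_add2l; apply: leq_sum => l _; exact: leq_subr.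
rewrite big_split [X in (_ <= X)%N -> _]big_split.
have -> : (\sum_(k < r) k.+1 * (\sum_(l < r | (l < k)%N) a l k) =
    \sum_(l < r) \sum_(k < r | (l < k)%N) k.+1 * a l k)%N.
  by under eq_bigr do rewrite big_distrr; rewrite (exchange_big_dep xpredT).
have le1 : (\sum_k i k <= \sum_(k < r) k.+1 * i k)%N.
  by apply: leq_sum => k _; rewrite leq_pmull.
(* On the left a_lk carries the weight k + 1 and on the right l + 1; since l < k, one copy is left
   over. *)
have le2 : (\sum_(l < r) l.+1 * (\sum_(k < r | (l < k)%N) a l k) +
    \sum_(l < r) \sum_(k < r | (l < k)%N) a l k <=
    \sum_(l < r) \sum_(k < r | (l < k)%N) k.+1 * a l k)%N.
  rewrite -big_split; apply: leq_sum => l _; rewrite big_distrr -big_split /=.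
  by apply: leq_sum => k lk; rewrite -mulSnr leq_mul2r ltnS lk orbT.
move=> main; move: le1 le2 main; set s1 := (\sum_k i k)%N; set s2 := (\sum_(k < r) _ * i k)%N.
set s3 := (\sum_(k < r) _ * c k)%N; set s4 := (\sum_(l < r) _.+1 * _)%N.
set s5 := (\sum_(l < r) _)%N; set s6 := (\sum_(l < r) _)%N.
move=> h1 h2 h3; have : (s2 + s6 <= s3 + s4)%N by []. lia.
Qed.

Section Expansion.
Variables (F : fieldType) (K : residue_field F).
Local Notation tau := (@tau F K _).
Variables (l r : nat) (rho : 'I_r -> nat) (N : nat).
Implicit Types (al : 'I_l -> F).
Hypothesis F0 : forall n, n.+1%:R != 0 :> F.
Hypothesis rho_gt0 : forall k, (0 < rho k)%N.

(** What [weighted_bound] yields for c k = rho k + 1. It is doubled in [boundN] because [rho k] and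
    the positive part of [exponent] are each estimated by it. *)
Local Notation bound := (\sum_(k < r) k.+1 * (rho k).+1)%N.
Hypothesis boundN : (bound + bound <= N)%N.

(* Up to factorials, Frobenius' coefficient at the exponents al k + (l - 1): each
   power sum of degree q lowers one of the exponents by q. *)
Fixpoint removals al (s : seq nat) : F :=
  if s is q :: s' then
    \sum_k ffactr (al k + (l%:R - 1)) q * removals (lower al k q%:R) s'
  else vand al.

(* An entry (e, a, b) stands for eps_ij = 2 e, a_ij = a, b_ij = b. *)
Definition entry : Type := (bool * 'I_N.+1 * 'I_N.+1)%type.
HB.instance Definition _ := Finite.on entry.
Definition entry0 : entry := (false, ord0, ord0).
Definition e_of (w : entry) : nat := w.1.1.*2.
Definition a_of (w : entry) : nat := w.1.2.
Definition b_of (w : entry) : nat := w.2.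

(** The convention a_ij = b_ij = 0 for eps_ij = 0 is turned into a weight: an entry with eps_ij = 0
    counts only if it is [entry0]. *)
Definition entry_weight (p q : 'I_r) (w : entry) : F :=
  if w.1.1 then (rho p * rho q)%:R * ('C((a_of w).+1, (b_of w).+1)%:R *
      (((rho p)%:R * (- (rho p)%:R) ^+ b_of w + (rho q)%:R ^+ (b_of w).+1)
        / ((rho p)%:R + (rho q)%:R)))
  else (w == entry0)%:R.

Local Notation row := {ffun 'I_r -> entry}.
Local Notation table := {ffun 'I_r -> row}.

(** The moment index for part k: the power of [al t] gathered when k is removed, minus the degrees
    lost to the earlier parts. Where b > a the truncated difference is harmless, since
    [entry_weight] is then 0. *)
Definition exponent (M : table) (k : 'I_r) : int :=
  (\sum_(q < r | (k < q)%N) (a_of (M k q) - b_of (M k q)))%N%:Z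
  - (\sum_(p < r | (p < k)%N) (a_of (M p k) + e_of (M p k)))%N%:Z.

Definition row_ok (p : nat) (v : row) := [forall j : 'I_r, (p < j)%N || (v j == entry0)].
Definition table_ok (p : nat) (M : table) :=
  [forall i : 'I_r, if (p <= i)%N then row_ok i (M i) else M i == [ffun=> entry0]].

Definition set_row (M : table) (p : 'I_r) (v : row) : table :=
  [ffun i => if i == p then v else M i].

Lemma sum_table_ok (p : 'I_r) (G : table -> F) :
  \sum_(M | table_ok p M) G M =
  \sum_(M | table_ok p.+1 M) \sum_(v | row_ok p v) G (set_row M p v).
Proof.
have lep (i : 'I_r) : i != p -> (p <= i)%N = (p < i)%N.
  by rewrite -val_eqE [RHS]ltn_neqAle eq_sym => ->.
rewrite pair_big /=.
rewrite (reindex_onto (fun x : table * row => set_row x.1 p x.2)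
           (fun M => (set_row M p [ffun=> entry0], M p))) /=.
  apply: eq_bigl => -[M v] /=.
  have -> : ((set_row (set_row M p v) p [ffun=> entry0], set_row M p v p) == (M, v)) =
     (M p == [ffun=> entry0]).
    rewrite xpair_eqE [X in _ && X](_ : _ = true) ?andbT; last by rewrite ffunE !eqxx.
    apply/eqP/eqP => [/ffunP /(_ p)|e]; first by rewrite !ffunE eqxx => ->.
    by apply/ffunP => i; rewrite !ffunE; case: eqP => // ->.
  apply/andP/andP => -[].
    move=> /forallP h1 /eqP h2; split.
      apply/forallP => i; have := h1 i; rewrite ffunE.
      case: (eqVneq i p) => [->|ip]; first by rewrite ltnn h2 eqxx.
      by rewrite lep.
    by have := h1 p; rewrite leqnn ffunE eqxx.
  move=> /forallP h1 h2; split; last by have := h1 p; rewrite ltnn.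
  apply/forallP => i; have := h1 i; rewrite ffunE.
  case: (eqVneq i p) => [->|ip]; first by rewrite leqnn.
  by rewrite lep.
move=> M _; apply/ffunP => i; rewrite !ffunE.
by case: eqP => // ->.
Qed.

(** Below the assumed lower bounds [tau] vanishes. They are the conditions of [weighted_bound] with
    i = 0, so all the a together are at most [bound]. *)
Lemma exponent_bound p M : table_ok p M ->
  (forall k : 'I_r, (p <= k)%N -> (- (rho k).+1%:Z <= exponent M k)%R) ->
  forall k, ((rho k)%:Z + exponent M k <= N%:Z)%R.
Proof.
move=> /forallP ok h k.
have row_out (i : 'I_r) : (i < p)%N -> M i = [ffun=> entry0].
  by move=> ip; have := ok i; rewrite leqNgt ip => /eqP.
have h' (i : 'I_r) : (- (rho i).+1%:Z <= exponent M i)%R.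
  case: (leqP p i) => ip; first exact: h.
  rewrite /exponent !big1; first by lia.
    by move=> q qi; rewrite row_out ?ffunE // (ltn_trans qi).
  by move=> q qi; rewrite row_out ?ffunE.
have := @weighted_bound r (fun i j => a_of (M i j)) (fun i j => b_of (M i j))
   (fun i j => e_of (M i j)) (fun k => (rho k).+1) (fun=> 0%N).
rewrite big1 // add0n => hb.
have {}hb : (\sum_(i < r) \sum_(j < r | (i < j)%N) a_of (M i j) <= bound)%N.
  apply: hb => i; have := h' i; rewrite /exponent add0n.
  move: (\sum_(q < r | _) _)%N (\sum_(q < r | _) _)%N => s t; lia.
have e1 : (\sum_(q < r | (k < q)%N) (a_of (M k q) - b_of (M k q)) <= bound)%N.
  apply: leq_trans hb; rewrite [X in (_ <= X)%N](bigD1 k) //=.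
  by apply: leq_trans (leq_addr _ _); apply: leq_sum => q _; exact: leq_subr.
have e2 : (rho k <= bound)%N.
  rewrite (bigD1 k) //=; apply: leq_trans (leq_addr _ _).
  by rewrite (leq_trans (leqnSn _)) // leq_pmull.
rewrite /exponent; move: e1 e2 boundN.
move: (\sum_(q < r | _) _)%N (\sum_(q < r | _) _)%N bound => s t B; lia.
Qed.

Lemma rho_neq0 k : (rho k)%:R != 0 :> F.
Proof. by rewrite -(prednK (rho_gt0 k)). Qed.

Lemma tau_entries al (t : 'I_l) p k (m : int) :
  ((rho k)%:Z + m <= N%:Z)%R || (m < - (rho k).+1%:Z)%R ->
  tau (lower al t (rho p)%:R) (rho k) m = \sum_(w : entry) entry_weight p k w *
    (al t ^+ (a_of w - b_of w) * tau al (rho k) (m - (a_of w + e_of w)%N%:Z)).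
Proof.
case/orP => hm; last first.
  rewrite tau_small // big1 // => w _; rewrite tau_small ?mulr0 //.
  by apply: le_lt_trans hm; rewrite lerBlDr lerDl.
have sum0 : (rho k + rho p)%:R != 0 :> F.
  by rewrite -(prednK (rho_gt0 k)) addSn.
rewrite (@tau_lower _ _ _ _ _ _ _ _ N.+1 (rho_neq0 k) sum0); last first.
  by apply: le_trans hm _; rewrite lez_nat.
rewrite (bigID (fun w : entry => w.1.1)) [RHS]addrC /=; congr (_ + _).
  rewrite (bigD1 entry0) //= [X in _ = _ + X]big1 => [|w /andP[/negPf wf /negPf w0]].
    have -> : (a_of entry0 - b_of entry0)%N = 0%N by [].
    have -> : (a_of entry0 + e_of entry0)%N = 0%N by [].
    by rewrite addr0 /entry_weight /= expr0 !mul1r subr0.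
  by rewrite /entry_weight wf w0 mul0r.
rewrite (reindex (fun ab : 'I_N.+1 * 'I_N.+1 => ((true, ab.1), ab.2) : entry)) /=; last first.
  exists (fun w : entry => (w.1.2, w.2)) => [[a b] _|[[e a] b]] //.
  by rewrite inE /= => ->.
rewrite mulr_sumr -(pair_bigA _ (fun a b : 'I_N.+1 => entry_weight p k (true, a, b) *
  (al t ^+ (a - b) * tau al (rho k) (m - (a + 2)%N%:Z)))) /=.
apply: eq_bigr => a _; rewrite mulr_sumr; apply: eq_bigr => b _.
rewrite /entry_weight /a_of /b_of /= -!mulrA.
have -> : m - a%:Z - 2%:Z = m - (a + 2)%N%:Z by lia.
by [].
Qed.

Lemma row_okP p (v : row) : (v \in pfamily entry0 (fun k : 'I_r => (p < k)%N) (fun=> predT))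
  = row_ok p v.
Proof.
apply/pfamilyP/forallP => [[/fintype.subsetP h _] j|h].
  case E: (p < j)%N => //=; apply/negPn/negP => vj.
  by have := h j vj; rewrite unfold_in /= E.
split=> //; apply/fintype.subsetP => j; have := h j; rewrite !unfold_in /=.
by case: (p < j)%N => //= /eqP ->; rewrite eqxx.
Qed.

Lemma exponent_set_row (p : 'I_r) M v : table_ok p.+1 M ->
  (forall k : 'I_r, (p < k)%N ->
    exponent (set_row M p v) k = exponent M k - (a_of (v k) + e_of (v k))%N%:Z) /\
  exponent (set_row M p v) p = (\sum_(q < r | (p < q)%N) (a_of (v q) - b_of (v q)))%N%:Z.
Proof.
move=> /forallP ok.
have row_out (i : 'I_r) : (i <= p)%N -> M i = [ffun=> entry0].
  by move=> ip; have := ok i; rewrite ltnNge ip => /eqP.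
split=> [k pk|].
  rewrite /exponent.
  rewrite (eq_bigr (fun q => (a_of (M k q) - b_of (M k q))%N)); last first.
    by move=> q _; rewrite ffunE -val_eqE gtn_eqF.
  suff -> : (\sum_(i < r | (i < k)%N) (a_of (set_row M p v i k) + e_of (set_row M p v i k)) =
      \sum_(i < r | (i < k)%N) (a_of (M i k) + e_of (M i k)) + (a_of (v k) + e_of (v k)))%N.
    by rewrite PoszD opprD addrA.
  rewrite (bigD1 p) //= [in RHS](bigD1 p) //= ffunE eqxx row_out // ffunE addnC.
  have -> : (a_of entry0 + e_of entry0)%N = 0%N by [].
  rewrite add0n; congr (_ + _)%N.
  by apply: eq_bigr => i /andP[_ /negPf ip]; rewrite ffunE ip.
rewrite /exponent [X in _ - X%:Z]big1 ?subr0 => [|i ip].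
  by congr Posz; apply: eq_bigr => q _; rewrite ffunE eqxx.
by rewrite ffunE -val_eqE ltn_eqF // row_out ?ffunE // ltnW.
Qed.

(* Row p of the table records the terms of tau_lower chosen for the parts after
   the p-th one when that part is removed. *)
Lemma removals_expansion p al : (p <= r)%N ->
  removals al (drop p [seq rho k | k <- enum 'I_r]) = vand al *
  \sum_(M | table_ok p M)
    (\prod_(i < r | (p <= i)%N) \prod_(j < r | (i < j)%N) entry_weight i j (M i j)) *
    \prod_(k < r | (p <= k)%N) tau al (rho k) (exponent M k).
Proof.
move=> pr; rewrite -(subKn pr); move: (r - p)%N (leq_subr p r) => {pr}d; clear p.
elim: d al => [|d IH] al dr.
  rewrite subn0 drop_oversize; last by rewrite size_map size_enum_ord.
  rewrite [LHS]/=.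
  rewrite (bigD1 [ffun=> [ffun=> entry0]]) /=; last first.
    by apply/forallP => i; rewrite leqNgt ltn_ord ffunE /= eqxx.
  rewrite [X in _ = _ * (_ + X)]big1 => [|M /andP[/forallP ok /eqP ne]].
    by rewrite !big_pred0 ?mulr1 ?addr0 ?mulr1 // => i; rewrite leqNgt ltn_ord.
  case: ne; apply/ffunP => i; rewrite ffunE; have := ok i.
  by rewrite leqNgt ltn_ord => /eqP.
set p := (r - d.+1)%N.
have pr : (p < r)%N by rewrite /p; lia.
have rd : (r - d = p.+1)%N by rewrite /p; lia.
rewrite rd in IH; have {}IH al' := IH al' (ltnW dr).
pose po := Ordinal pr.
rewrite (drop_nth 0%N); last by rewrite size_map size_enum_ord.
rewrite [LHS]/=.
have -> : nth 0%N [seq rho k | k <- enum 'I_r] p = rho po.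
  by rewrite (nth_map po) ?size_enum_ord // -[p]/(val po) nth_ord_enum.
rewrite (@sum_table_ok po).
pose wts (M : table) := \prod_(i < r | (p < i)%N) \prod_(j < r | (i < j)%N) entry_weight i j (M i j).
have step t (M : table) : table_ok p.+1 M ->
  \prod_(k < r | (p < k)%N) tau (lower al t (rho po)%:R) (rho k) (exponent M k) =
  \sum_(v | row_ok p v) (\prod_(k < r | (p < k)%N) entry_weight po k (v k)) *
    al t ^+ (\sum_(k < r | (p < k)%N) (a_of (v k) - b_of (v k))) *
    \prod_(k < r | (p < k)%N)
       tau al (rho k) (exponent M k - (a_of (v k) + e_of (v k))%N%:Z).
  move=> okM.
  transitivity (\prod_(k < r | (p < k)%N) \sum_(w : entry) entry_weight po k w *
    (al t ^+ (a_of w - b_of w) * tau al (rho k) (exponent M k - (a_of w + e_of w)%N%:Z))).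
    (* If some exponent lies below the range of [tau], both products vanish whatever the others are;
       otherwise [exponent_bound] justifies the truncation in every factor. *)
    have [/forallP small|] := boolP [forall k : 'I_r, (p < k)%N ==>
        (- (rho k).+1%:Z <= exponent M k)%R].
      apply: eq_bigr => k pk; apply: tau_entries.
      rewrite (@exponent_bound p.+1) // => k' pk'; exact: implyP (small k') pk'.
    rewrite negb_forall => /existsP[k]; rewrite negb_imply -ltNge => /andP[pk hk].
    rewrite (bigD1 k) //= [RHS](bigD1 k) //= -tau_entries ?hk ?orbT //.
    by rewrite tau_small // !mul0r.
  rewrite (big_distr_big_dep entry0 _ (fun=> predT)).
  rewrite (eq_bigl _ _ (row_okP p)); apply: eq_bigr => v _.
  by rewrite !big_split /= prodrXr mulrA.
transitivity (\sum_t ffactr (al t + (l%:R - 1)) (rho po) * vand (lower al t (rho po)%:R) *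
  \sum_(M | table_ok p.+1 M) \sum_(v | row_ok p v)
    (wts M * (\prod_(k < r | (p < k)%N) entry_weight po k (v k)) *
    \prod_(k < r | (p < k)%N)
       tau al (rho k) (exponent M k - (a_of (v k) + e_of (v k))%N%:Z)) *
    al t ^+ (\sum_(k < r | (p < k)%N) (a_of (v k) - b_of (v k)))).
  apply: eq_bigr => t _; rewrite IH mulrA; congr (_ * _).
  apply: eq_bigr => M okM; rewrite step // mulr_sumr; apply: eq_bigr => v _.
  by rewrite /wts; ring.
under eq_bigr => t _.
  rewrite mulr_sumr; under eq_bigr => M _ do rewrite mulr_sumr.
  over.
rewrite exchange_big mulr_sumr /=; apply: eq_bigr => M okM.
rewrite exchange_big mulr_sumr /=; apply: eq_bigr => v okv.
have [e1 e2] := @exponent_set_row po M v okM.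
have -> : \prod_(i < r | (p <= i)%N) \prod_(j < r | (i < j)%N)
     entry_weight i j (set_row M po v i j) =
   (\prod_(k < r | (p < k)%N) entry_weight po k (v k)) * wts M.
  rewrite (bigD1 po) //=; congr (_ * _).
    by apply: eq_bigr => j _; rewrite ffunE eqxx.
  apply: eq_big => [i|i /andP[_ /negPf ip]]; first by rewrite -val_eqE /= ltn_neqAle andbC eq_sym.
  by apply: eq_bigr => j _; rewrite ffunE ip.
rewrite [\prod_(k < r | (p <= k)%N) _](bigD1 po) //= e2.
have -> : \prod_(i < r | (p <= i)%N && (i != po)) tau al (rho i) (exponent (set_row M po v) i) =
   \prod_(k < r | (p < k)%N) tau al (rho k) (exponent M k - (a_of (v k) + e_of (v k))%N%:Z).
  apply: eq_big => [i|i /andP[pi ip]]; first by rewrite -val_eqE /= ltn_neqAle andbC eq_sym.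
  by rewrite e1 // ltn_neqAle pi andbT eq_sym.
(* The powers of [al t] collected along row p form a moment, so the sum over t becomes [vand al]
   times [tau] at the exponent of part p. *)
have := vand_moment K al (\sum_(k < r | (p < k)%N) (a_of (v k) - b_of (v k))) (rho_neq0 po).
set T := \prod_(k < r | (p < k)%N) tau al _ _ => vm.
set A := (\prod_(k < r | (p < k)%N) _) * wts M.
rewrite [RHS]mulrCA [vand al * _]mulrA -vm mulr_suml mulr_sumr.
by apply: eq_bigr => t _; rewrite /A; ring.
Qed.

End Expansion.

(** * Reduction of the sums in the statement to finite tables *)

Section FiniteSupport.
Local Open Scope classical_set_scope.

Lemma fsbig_fin (R : nmodType) (T : finType) (U : choiceType) (h : T -> U)
    (A : set U) (G : U -> R) :
  injective h -> (forall u, A u -> G u != 0 -> exists t, u = h t) ->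
  \sum_(u \in A) G u = \sum_(t | `[< A (h t) >]) G (h t).
Proof.
move=> inj supp; have -> : A = [set` [pred u | `[< A u >]]].
  by apply/seteqP; split => u /= /asboolP.
rewrite -(@bigfs _ _ _ _ [seq h t | t <- enum T]); first last.
- move=> u /asboolP Au nin; apply/eqP; apply: contraNT nin => Gu.
  by have [t ->] := supp u Au Gu; rewrite map_f // mem_enum.
- by rewrite map_inj_uniq ?enum_uniq.
rewrite big_map big_enum_cond /=; apply: eq_bigl => t.
by apply/asboolP/asboolP => /asboolP.
Qed.

End FiniteSupport.

Section FiniteSums.
Local Open Scope classical_set_scope.
Variables (K : residue_field algC) (r : nat) (rho : r.-tuple nat) (la : seq nat).
Hypothesis rho_gt0 : forall k, (0 < tnth rho k)%N.
Local Notation rhof := (fun k : 'I_r => tnth rho k).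
Local Notation bound := (\sum_(k < r) k.+1 * (tnth rho k).+1)%N.
Variables (N Nc : nat).
Hypothesis boundN : (bound <= N)%N.
Hypothesis boundNc : (r * N + bound + 2 <= Nc)%N.
Local Notation entry := (entry N).
Local Notation table := {ffun 'I_r -> {ffun 'I_r -> entry}}.
Local Notation c k := (c_coef la ((tnth rho k)%:R : algC)).

Definition Aterm (e : 'M[nat]_r) (i : {ffun 'I_r -> nat}) (ab : 'M[nat]_r * 'M[nat]_r) : algC :=
  (\prod_(p < r) \prod_(q < r | (p < q)%N) pair_weight rho e ab.1 ab.2 p q) *
   \prod_(k < r) (stirling1 (tnth rho k).+1 (stirling_arg e ab.1 ab.2 i k))%:~R.

Lemma weights_le (e : 'M[nat]_r) (a b : 'M[nat]_r) :
  \prod_(p < r) \prod_(q < r | (p < q)%N) pair_weight rho e a b p q != 0 ->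
  forall p q : 'I_r, (p < q)%N -> (b p q <= a p q)%N.
Proof.
move=> h p q pq; rewrite leqNgt; apply: contraNN h => ab.
by rewrite (bigD1 p) //= (bigD1 q) //= /pair_weight bin_small // mulr0 !mul0r.
Qed.

Lemma stirling_argE e (a b : 'M[nat]_r) i k :
  (forall p q : 'I_r, (p < q)%N -> (b p q <= a p q)%N) ->
  stirling_arg e a b i k = (i k)%:Z
   - ((\sum_(q < r | (k < q)%N) (a k q - b k q))%N%:Z
      - (\sum_(p < r | (p < k)%N) (a p k + e p k))%N%:Z).
Proof.
move=> ba; rewrite /stirling_arg opprB addrA; congr (_ + _ - _).
  by rewrite -natz natr_sum; apply: eq_bigr => p _; rewrite natz PoszD.
by rewrite -natz natr_sum; apply: eq_bigr => q kq; rewrite natz subzn // ba.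
Qed.

(** A nonzero binomial coefficient forces b <= a, and a nonzero Stirling number has argument at most
    rho_k + 1; the latter conditions are the hypotheses of [weighted_bound]. *)
Lemma Aterm_supp e i ab : ab_set e ab -> Aterm e i ab != 0 ->
  (forall k, (i k <= bound)%N) /\
  (forall p q, (ab.1 p q <= bound)%N /\ (ab.2 p q <= bound)%N).
Proof.
case: ab => a b [/= ua ub _]; rewrite mulf_eq0 negb_or /= => /andP[/weights_le ba st].
have hb : (\sum_k i k + \sum_(l < r) \sum_(k < r | (l < k)%N) a l k <= bound)%N.
  apply: (@weighted_bound _ a b e (fun k => (tnth rho k).+1)) => k.
  have : stirling1 (tnth rho k).+1 (stirling_arg e a b i k) != 0.
    by apply: contraNneq st => s0; rewrite (bigD1 k) //= s0 mul0r.
  have : ~~ ((stirling_arg e a b i k < 0) || ((tnth rho k).+1%:Z < stirling_arg e a b i k)) ->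
    (i k + \sum_(l < r | (l < k)%N) (a l k + e l k) <=
      (tnth rho k).+1 + \sum_(q < r | (k < q)%N) (a k q - b k q))%N.
    rewrite stirling_argE //; move: (\sum_(l < r | _) _)%N (\sum_(l < r | _) _)%N => s t.
    lia.
  move=> h s0; apply: h; apply: contraNN s0 => s0; by rewrite stirling1_eq0.
have aP p q : (a p q <= bound)%N.
  case: (leqP q p) => pq; first by rewrite ua.
  apply: leq_trans hb; apply: leq_trans (leq_addl _ _).
  rewrite (bigD1 p) //= (bigD1 q) //= -addnA; exact: leq_addr.
split=> [k|p q].
  apply: leq_trans hb; apply: leq_trans (leq_addr _ _).
  by rewrite (bigD1 k) //=; exact: leq_addr.
split=> //; case: (leqP q p) => pq; first by rewrite ub.
by rewrite (leq_trans (ba _ _ pq)).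
Qed.

Local Notation etable := {ffun 'I_r -> {ffun 'I_r -> bool}}.
Local Notation abtable := {ffun 'I_r -> {ffun 'I_r -> 'I_N.+1 * 'I_N.+1}}.

Definition e_mx (t : etable) : 'M[nat]_r := \matrix_(i, j) (t i j).*2.
Definition ab_mx (t : abtable) : 'M[nat]_r * 'M[nat]_r :=
  (\matrix_(i, j) ((t i j).1 : nat), \matrix_(i, j) ((t i j).2 : nat)).
Definition merge_tables (te : etable) (tab : abtable) : table :=
  [ffun i => [ffun j => ((te i j, (tab i j).1), (tab i j).2)]].

Lemma merge_tablesE te tab i j :
  merge_tables te tab i j = (te i j, (tab i j).1, (tab i j).2).
Proof. by rewrite /merge_tables !ffunE. Qed.

Lemma e_mx_inj : injective e_mx.
Proof.
move=> t u /matrixP tu; apply/ffunP => i; apply/ffunP => j.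
by have := tu i j; rewrite !mxE; case: (t i j); case: (u i j).
Qed.

Lemma ab_mx_inj : injective ab_mx.
Proof.
move=> t u [/matrixP tu1 /matrixP tu2]; apply/ffunP => i; apply/ffunP => j.
have := tu1 i j; have := tu2 i j; rewrite !mxE; case: (t i j) (u i j) => [a b] [a' b'] /=.
by move=> /val_inj -> /val_inj ->.
Qed.

Lemma eps_set_e_mx e : eps_set e -> exists t, e = e_mx t.
Proof.
case=> /= up e02; exists [ffun i => [ffun j => e i j == 2%N]].
apply/matrixP => i j; rewrite !mxE !ffunE; case: (leqP j i) => ij; first by rewrite up.
by case: (e02 i j ij) => ->.
Qed.

Lemma ab_set_ab_mx (ab : 'M[nat]_r * 'M[nat]_r) :
  (forall p q, (ab.1 p q <= N)%N /\ (ab.2 p q <= N)%N) -> exists t, ab = ab_mx t.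
Proof.
case: ab => a b /= h; exists [ffun i => [ffun j => (inord (a i j), inord (b i j))]].
by congr (_, _); apply/matrixP => i j; rewrite !mxE !ffunE /= inordK // ltnS;
  have [] := h i j.
Qed.

Lemma merge_tables_bij :
  bijective (fun x : etable * abtable => merge_tables x.1 x.2).
Proof.
exists (fun M : table => ([ffun i => [ffun j => (M i j).1.1]],
                  [ffun i => [ffun j => ((M i j).1.2, (M i j).2)]])).
  move=> [t u]; congr (_, _); apply/ffunP => i; apply/ffunP => j;
    rewrite !ffunE /= ?merge_tablesE //=.
  by case: (u i j).
move=> M; apply/ffunP => i; apply/ffunP => j; rewrite merge_tablesE !ffunE /=.
by case: (M i j) => [[]].
Qed.

Definition tables_ok te tab := `[< eps_set (e_mx te) >] && `[< ab_set (e_mx te) (ab_mx tab) >].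

Lemma tables_okP te tab : reflect
  ((forall i j : 'I_r, (j <= i)%N -> merge_tables te tab i j = entry0 N) /\
   (forall i j : 'I_r, (i < j)%N -> te i j = false -> merge_tables te tab i j = entry0 N))
  (tables_ok te tab).
Proof.
have mE i j : (merge_tables te tab i j == entry0 N) =
    [&& ~~ te i j, (tab i j).1 == 0%N :> nat & (tab i j).2 == 0%N :> nat].
  by rewrite merge_tablesE /entry0 !xpair_eqE eqbF_neg -!val_eqE /= andbA.
apply: (iffP andP) => [[/asboolP[/= eu e02] /asboolP[/= au bu ab0]]|[h1 h2]].
  split=> i j ij => [|te0]; apply/eqP; rewrite mE.
    have := eu i j ij; have := au i j ij; have := bu i j ij; rewrite !mxE.
    by move=> -> ->; case: (te i j).
  have [] := ab0 i j ij; rewrite ?mxE ?te0 //.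
  by move=> -> ->.
have mE' i j : merge_tables te tab i j = entry0 N ->
   [/\ te i j = false, (tab i j).1 = 0%N :> nat & (tab i j).2 = 0%N :> nat].
  by move=> /eqP; rewrite mE => /and3P[/negPf ? /eqP ? /eqP ?].
split; apply/asboolP.
  split=> [i j ij|i j ij] /=; rewrite mxE.
    by have [-> _ _] := mE' _ _ (h1 i j ij).
  by case: (te i j); [right|left].
split=> /= i j ij; rewrite ?mxE.
- by have [_ -> _] := mE' _ _ (h1 i j ij).
- by have [_ _ ->] := mE' _ _ (h1 i j ij).
- move=> te0; have {}te0 : te i j = false by case: (te i j) te0.
  by have [_ -> ->] := mE' _ _ (h2 i j ij te0).
Qed.

Lemma weight_merge te tab (p q : 'I_r) : tables_ok te tab -> (p < q)%N ->
  pair_weight rho (e_mx te) (ab_mx tab).1 (ab_mx tab).2 p q =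
  entry_weight algC rhof p q (merge_tables te tab p q).
Proof.
move=> /tables_okP[_ h2] pq; rewrite /pair_weight /entry_weight /theta !mxE.
have [tpq|tpq] := boolP (te p q).
  have -> : (merge_tables te tab p q).1.1 by rewrite merge_tablesE.
  by rewrite merge_tablesE /a_of /b_of -[true.*2 == 0%N]/false -mulrA.
have e0 := h2 p q pq (negPf tpq).
have [-> ->] : (tab p q).1 = ord0 /\ (tab p q).2 = ord0.
  by have := e0; rewrite merge_tablesE; case=> _ -> ->.
rewrite e0 /= ?eqxx binn expr0 expr1 !mulr1 mul1r divff // -natrD pnatr_eq0.
by rewrite -lt0n addn_gt0 rho_gt0.
Qed.

Lemma exponent_merge te tab k :
  exponent (merge_tables te tab) k =
  (\sum_(q < r | (k < q)%N) ((ab_mx tab).1 k q - (ab_mx tab).2 k q))%N%:Z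
   - (\sum_(p < r | (p < k)%N) ((ab_mx tab).1 p k + e_mx te p k))%N%:Z.
Proof.
rewrite /exponent; congr (Posz _ - Posz _); apply: eq_bigr => p _.
  by rewrite !mxE /a_of /b_of merge_tablesE.
by rewrite !mxE /a_of /e_of merge_tablesE.
Qed.

(** A crude estimate by the at most r entries of a row, uniform in M because the range [Nc] of the
    i_k is fixed before the table. *)
Lemma exponent_lt (M : table) k : ((tnth rho k).+1%:Z + exponent M k < Nc%:Z)%R.
Proof.
have e1 : (\sum_(q < r | (k < q)%N) (a_of (M k q) - b_of (M k q)) <= r * N)%N.
  rewrite -[X in (X * N)%N]card_ord -sum_nat_const big_mkcond.
  apply: leq_sum => q _; case: ifP => // _.
  by rewrite (leq_trans (leq_subr _ _)) // -ltnS ltn_ord.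
have e2 : (tnth rho k <= bound)%N.
  rewrite (bigD1 k) //=; apply: leq_trans (leq_addr _ _).
  by rewrite (leq_trans (leqnSn _)) // leq_pmull.
rewrite /exponent; move: e1 e2 boundNc.
move: (\sum_(q < r | _) _)%N (\sum_(q < r | _) _)%N bound (r * N)%N => s t B D; lia.
Qed.

Lemma expansion_finite :
  \sum_(e \in @eps_set r) \sum_(i \in [set: {ffun 'I_r -> nat}])
      (Acoef rho e i * \prod_(k < r) c k (i k)) =
  \sum_(M : table | table_ok 0 M)
    (\prod_(p < r | (0 <= p)%N) \prod_(q < r | (p < q)%N) entry_weight algC rhof p q (M p q)) *
    \prod_(k < r | (0 <= k)%N) tau K (@content_ends algC la) (tnth rho k) (exponent M k).
Proof.
rewrite (fsbig_fin e_mx_inj); last by move=> e /eps_set_e_mx.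
pose h (t : {ffun 'I_r -> 'I_Nc}) : {ffun 'I_r -> nat} := [ffun k => t k : nat].
have h_inj : injective h.
  by move=> t u /ffunP tu; apply/ffunP => k; apply: val_inj; have := tu k; rewrite !ffunE.
have AcoefE e i : Acoef rho e i = \sum_(ab \in ab_set e) Aterm e i ab by [].
have AcoefE' e i : Acoef rho e i =
    \sum_(t | `[< ab_set e (ab_mx t) >]) Aterm e i (ab_mx t).
  rewrite AcoefE (fsbig_fin ab_mx_inj) // => ab abe nz.
  have [_ le] := Aterm_supp abe nz; apply: ab_set_ab_mx => p q.
  by have [l1 l2] := le p q; split; apply: leq_trans boundN.
transitivity (\sum_(te | `[< eps_set (e_mx te) >])
  \sum_(tab | `[< ab_set (e_mx te) (ab_mx tab) >])
    (\prod_(p < r) \prod_(q < r | (p < q)%N) entry_weight algC rhof p q (merge_tables te tab p q)) *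
    \prod_(k < r) tau K (@content_ends algC la) (tnth rho k) (exponent (merge_tables te tab) k)).
  apply: eq_bigr => te ete.
  rewrite (fsbig_fin h_inj); last first.
    move=> i _; rewrite mulf_eq0 negb_or => /andP[Anz _].
    have [ab abe nz] : exists2 ab, ab_set (e_mx te) ab & Aterm (e_mx te) i ab != 0.
      apply: contrapT => no; move/eqP: Anz; apply; rewrite AcoefE fsbig1 // => ab abe.
      by apply/eqP; apply: contrapT => /negP nz; apply: no; exists ab.
    have [le _] := Aterm_supp abe nz.
    have lt k : (i k < Nc)%N.
      apply: leq_ltn_trans (le k) _; move: boundNc; move: bound (r * N)%N => B D; lia.
    by exists [ffun k => Ordinal (lt k)]; apply/ffunP => k; rewrite !ffunE.
  under eq_bigr => t _ do rewrite AcoefE' mulr_suml.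
  rewrite exchange_big /=; apply: eq_bigr => tab abt.
  have ok : tables_ok te tab by rewrite /tables_ok ete abt.
  have -> : \prod_(p < r) \prod_(q < r | (p < q)%N)
        entry_weight algC rhof p q (merge_tables te tab p q) =
      \prod_(p < r) \prod_(q < r | (p < q)%N)
        pair_weight rho (e_mx te) (ab_mx tab).1 (ab_mx tab).2 p q.
    by apply: eq_bigr => p _; apply: eq_bigr => q pq; rewrite weight_merge.
  rewrite /Aterm.
  set W := \prod_(p < r) \prod_(q < r | _) _.
  (* [stirling_argE] requires b <= a, which is known only when the weight W is nonzero; otherwise
     both sides are 0. *)
  have [W0|W0] := eqVneq W 0; first by rewrite W0 mul0r big1 // => t _; rewrite !mul0r.
  have ba := weights_le W0.
  rewrite [X in _ = W * X](eq_bigr (fun k => \sum_(i < Nc) (stirling1 (tnth rho k).+1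
     (i%:Z - exponent (merge_tables te tab) k))%:~R * c k i)); last first.
    by move=> k _; apply: tau_contents (exponent_lt _ k); rewrite pnatr_eq0 -lt0n.
  rewrite bigA_distr_bigA mulr_sumr /=.
  apply: eq_big => [t|t _]; first by apply/asboolP.
  rewrite -mulrA -big_split; congr (_ * _); apply: eq_bigr => k _ /=.
  by rewrite stirling_argE // exponent_merge // !ffunE.
rewrite pair_big_dep /= (reindex _ (onW_bij _ merge_tables_bij)) /=.
rewrite big_mkcond [RHS]big_mkcond; apply: eq_bigr => -[te tab] _ /=.
have [ok|nok] := boolP (tables_ok te tab).
  have [h1 h2] := tables_okP _ _ ok.
  rewrite -/(tables_ok te tab) ok ifT //.
  by apply/forallP => i /=; apply/forallP => j; case: ltnP => //= ji; rewrite h1.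
rewrite -/(tables_ok te tab) (negPf nok); case: ifP => // /forallP ok.
(* A triangular table violating the convention for eps_ij = 0 has weight 0. *)
have [/existsP[i /existsP[j /and3P[ij te0 nz]]]|] := boolP [exists i : 'I_r, exists j : 'I_r,
    [&& (i < j)%N, ~~ te i j & merge_tables te tab i j != entry0 N]].
  rewrite (bigD1 i) //= (bigD1 j) //= /entry_weight.
  have -> : (merge_tables te tab i j).1.1 = false by rewrite merge_tablesE (negPf te0).
  by rewrite (negPf nz) !mul0r.
rewrite negb_exists => /forallP no; case/negP: nok; apply/tables_okP; split=> i j ij.
  have /forallP/(_ j) := ok i; rewrite ltnNge ij => /eqP //.
move=> te0; have := no i; rewrite negb_exists => /forallP/(_ j).
by rewrite ij te0 /= negbK => /eqP.
Qed.

End FiniteSums.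

(** * Words and permutation characters *)

Section Words.
Variables (n : nat) (T : finType).
Local Notation word := {ffun 'I_n -> T}.
Implicit Types (f g : word) (s t : 'S_n) (m : {ffun T -> nat}).

Definition content f : {ffun T -> nat} := [ffun x => \sum_i (f i == x)]%N.

Definition permute_word f s : word := [ffun i => f (s i)].

Definition word_fixed f s := permute_word f s == f.

Lemma permute_wordM f s t : permute_word (permute_word f t) s = permute_word f (s * t)%g.
Proof. by apply/ffunP => i; rewrite !ffunE permM. Qed.

Lemma permute_word1 f : permute_word f 1%g = f.
Proof. by apply/ffunP => i; rewrite ffunE perm1. Qed.

Definition word_stab f : {set 'S_n} := [set s | word_fixed f s].

Lemma word_stab_group_set f : group_set (word_stab f).
Proof.
apply/group_setP; split=> [|s t]; rewrite !inE /word_fixed ?permute_word1 //.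
by move=> /eqP fs /eqP ft; rewrite -permute_wordM ft fs.
Qed.

Canonical word_stab_group f : {group 'S_n} := Group (word_stab_group_set f).

Lemma sum_content f : (\sum_x content f x)%N = n.
Proof.
under eq_bigr do rewrite ffunE.
rewrite exchange_big /= -[RHS]card_ord -sum1_card; apply: eq_bigr => i _.
by rewrite (bigD1 (f i)) //= eqxx big1 // => x; rewrite eq_sym => /negPf ->.
Qed.

Lemma content_count f x : content f x = count_mem x [tuple f i | i < n].
Proof.
rewrite ffunE -sum1_count big_tuple [RHS]big_mkcond.
by apply: eq_bigr => i _; rewrite tnth_map tnth_ord_tuple /=; case: (f i == x).
Qed.

Lemma content_permute f s : content (permute_word f s) = content f.
Proof.
apply/ffunP => x; rewrite !ffunE [RHS](reindex_inj (@perm_inj _ s)) /=.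
by apply: eq_bigr => i _; rewrite ffunE.
Qed.

Lemma content_eqP f g : content f = content g -> exists s, g = permute_word f s.
Proof.
move=> /ffunP fg.
have /tuple_permP[p pE] : perm_eq [tuple g i | i < n] [tuple f i | i < n].
  apply/allP => x _; apply/eqP.
  by rewrite -!content_count -fg.
exists p; apply/ffunP => i; rewrite ffunE.
have /(congr1 (fun u => nth (f i) u i)) := pE.
by rewrite -!tnth_nth !tnth_map !tnth_ord_tuple.
Qed.

Lemma card_permute_to f g : content f = content g ->
  #|[set s | permute_word f s == g]| = #|word_stab f|.
Proof.
move=> /content_eqP[t ->].
rewrite -(card_lcoset (word_stab f) t); apply: eq_card => s; rewrite inE mem_lcoset inE.
rewrite /word_fixed -permute_wordM; apply/eqP/eqP => [->|e].
  by rewrite permute_wordM mulVg permute_word1.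
by rewrite -[LHS]permute_word1 -(mulgV t) -permute_wordM e.
Qed.

Lemma content_word m : (\sum_x m x)%N = n -> exists f, content f = m.
Proof.
move=> sm; pose s := flatten [seq nseq (m x) x | x <- enum T].
have ss : size s == n.
  by rewrite size_flatten /shape -map_comp sumnE big_map big_enum -sm; apply/eqP/eq_bigr => x _;
     rewrite /= size_nseq.
exists [ffun i => tnth (Tuple ss) i]; apply/ffunP => x.
rewrite content_count.
have -> : count_mem x [tuple [ffun i => tnth (Tuple ss) i] i | i < n] = count_mem x s.
  rewrite -[s]/(tval (Tuple ss)); congr (count_mem x (tval _)).
  by apply: eq_from_tnth => i; rewrite tnth_map tnth_ord_tuple ffunE.
rewrite count_flatten -map_comp sumnE big_map big_enum (bigD1 x) //= count_nseq /= eqxx mul1n.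
by rewrite big1 ?addn0 // => y; rewrite count_nseq /= => /negPf ->.
Qed.

Lemma prod_word (A : comNzRingType) (z : T -> A) f :
  \prod_i z (f i) = \prod_x z x ^+ content f x.
Proof.
under [RHS]eq_bigr => x _ do rewrite ffunE expr_sum.
rewrite exchange_big /=; apply: eq_bigr => i _.
by rewrite (bigD1 (f i)) //= eqxx expr1 big1 ?mulr1 // => x; rewrite eq_sym => /negPf ->.
Qed.

Lemma sum_card_stab m : (\sum_x m x)%N = n ->
  (\sum_(f | content f == m) #|word_stab f| = n`!)%N.
Proof.
move=> /content_word[f0 <-].
transitivity (\sum_(f | content f == content f0) \sum_(s | permute_word f s == f0) 1)%N.
  apply: eq_bigr => f /eqP e; rewrite -(card_permute_to e) -sum1_card.
  by apply: eq_bigl => s; rewrite inE.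
rewrite (exchange_big_dep xpredT) //= -card_Sn -sum1_card.
rewrite [RHS](eq_bigl xpredT); last by move=> s; rewrite inE.
apply: eq_bigr => s _; rewrite (big_pred1 (permute_word f0 s^-1)) // => f.
apply/andP/eqP => [[_ /eqP <-]|->].
  by rewrite permute_wordM mulVg permute_word1.
by rewrite content_permute permute_wordM mulgV permute_word1.
Qed.

(* Burnside's orbit counting for the action of S_n on words; the orbits are the
   contents. *)
Lemma sum_fixed_words (A : comNzRingType) (z : T -> A) N : (n <= N)%N ->
  \sum_(s : 'S_n) \sum_(f | word_fixed f s) \prod_i z (f i) =
  n`!%:R * \sum_(m : {ffun T -> 'I_N.+1} | (\sum_x m x)%N == n) \prod_x z x ^+ m x.
Proof.
move=> nN; rewrite (exchange_big_dep xpredT) //=.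
pose c f : {ffun T -> 'I_N.+1} := [ffun x => inord (content f x)].
have cE f x : c f x = content f x :> nat.
  rewrite ffunE inordK // ltnS (leq_trans _ nN) // -[X in (_ <= X)%N](sum_content f).
  by rewrite (bigD1 x) //= leq_addr.
rewrite (partition_big c (fun k : {ffun T -> 'I_N.+1} => (\sum_x k x)%N == n)) /=; last first.
  by move=> f _; rewrite (eq_bigr _ (fun x _ => cE f x)) sum_content.
rewrite mulr_sumr; apply: eq_bigr => m /eqP sm.
pose m' : {ffun T -> nat} := [ffun x => m x : nat].
have e : (\sum_x m' x)%N = n by rewrite -[RHS]sm; apply: eq_bigr => x _; rewrite ffunE.
rewrite -(sum_card_stab e) natr_sum mulr_suml.
have cm f : (c f == m) = (content f == m').
  apply/eqP/eqP => [h|/ffunP h]; apply/ffunP => x; first by rewrite [RHS]ffunE -h cE.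
  by apply: val_inj; rewrite /= cE h ffunE.
rewrite (eq_bigl _ _ cm); apply: eq_bigr => f /eqP cf.
rewrite prod_word cf sumr_const -[LHS]mulr_natl.
have -> : #|[pred s | word_fixed f s]| = #|word_stab f| by apply: eq_card => s; rewrite !inE.
by congr (_ * _); apply: eq_bigr => x _; rewrite ffunE.
Qed.

(** The words of one content form an orbit. A conjugate s ^ y stabilises [f0] iff s fixes
    [permute_word f0 y], and each word of the orbit arises from as many y as the stabiliser has
    elements. *)
Lemma Ind_word_stab f0 s :
  'Ind[[set: 'S_n], word_stab_group f0] 1 s =
  #|[set f | (content f == content f0) && word_fixed f s]|%:R.
Proof.
rewrite cfIndE ?finset.subsetT //.
have fixJ (y : 'S_n) : (s ^ y \in word_stab f0)%g = word_fixed (permute_word f0 y) s.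
  rewrite inE /word_fixed conjgE -!permute_wordM; apply/eqP/eqP => e.
    by rewrite -{2}e [RHS]permute_wordM mulgV permute_word1.
  by rewrite e permute_wordM mulVg permute_word1.
have -> : \sum_(y in [set: 'S_n]) (1 : 'CF(word_stab_group f0)) (s ^ y)%g =
    (\sum_(f | (content f == content f0) && word_fixed f s)
       #|[set y | permute_word f0 y == f]|)%:R.
  rewrite natr_sum.
  transitivity (\sum_(y : 'S_n) \sum_(f | [&& content f == content f0, word_fixed f s
      & permute_word f0 y == f]) 1 : algC).
    apply: eq_big => [y|y _]; first by rewrite inE.
    rewrite cfun1E fixJ; case fy: (word_fixed _ _); last first.
      by rewrite big_pred0 // => f; case: eqP => // _; case ff: (word_fixed f s) => //=;
        case: eqP => // e; rewrite -e fy in ff.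
    rewrite (big_pred1 (permute_word f0 y)) // => f.
    by apply/and3P/eqP => [[_ _ /eqP <-]|->] //; rewrite content_permute !eqxx fy.
  rewrite (exchange_big_dep (fun f => (content f == content f0) && word_fixed f s)) /=; last first.
    by move=> y f _ /and3P[-> ->].
  apply: eq_bigr => f /andP[-> ->].
  by rewrite sumr_const; congr (_ *+ _); apply: eq_card => y; rewrite !inE.
rewrite (eq_bigr (fun=> #|word_stab f0|)) => [|f /andP[/eqP e _]]; last first.
  by rewrite (card_permute_to (esym e)).
rewrite sum_nat_const natrM mulrCA mulVf ?mulr1; last by rewrite pnatr_eq0 -lt0n cardG_gt0.
by congr (_ %:R); apply: eq_card => f; rewrite !inE.
Qed.

(** The default 0 is reached when the entries of m do not sum to n, so that no word has content
    m. *)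
Definition perm_char m : 'CF([set: 'S_n]) :=
  if [pick f | content f == m] is Some f0 then 'Ind[[set: 'S_n], word_stab_group f0] 1
  else 0.

Lemma perm_charE m s :
  perm_char m s = #|[set f | (content f == m) && word_fixed f s]|%:R.
Proof.
rewrite /perm_char; case: pickP => [f0 /eqP <-|no]; first exact: Ind_word_stab.
rewrite cfunE; set A := [set f | _].
have -> : A = finset.set0; last by rewrite cards0.
by apply/setP => f; rewrite !inE no.
Qed.

Lemma perm_char_char m : perm_char m \is a character.
Proof.
rewrite /perm_char; case: pickP => [f0 _|_]; last exact: rpred0.
by rewrite cfInd_char ?rpred1.
Qed.

End Words.

(** * Cauchy's identity and the norm *)

Section CauchyDeterminant.
Variables (A : comNzRingType) (l : nat).
Implicit Types (x y : 'I_l -> A).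

Definition stair l (i : 'I_l) : nat := (l.-1 - i)%N.

Definition alternant (R : comNzRingType) l (x : 'I_l -> R) : R :=
  \det (\matrix_(i < l, j < l) x i ^+ stair j).

Lemma rmorph_alternant (R R' : comNzRingType) (phi : {rmorphism R -> R'}) (v : 'I_l -> R) :
  phi (alternant v) = alternant (phi \o v).
Proof.
rewrite /alternant -det_map_mx; congr (\det _); apply/matrixP => i j.
by rewrite !mxE rmorphXn.
Qed.

(** The reciprocal polynomial: the left side is t^d R(1/t), for R the product of the X - y and d its
    degree. *)
Lemma prod_subC_rev (R : comNzRingType) (s : seq R) (t : R) :
  \prod_(y <- s) (1 - t * y) =
  \sum_(m < (size s).+1) (\prod_(y <- s) ('X - y%:P))`_m * t ^+ (size s - m).
Proof.
elim: s => [|y s IH]; first by rewrite !big_nil big_ord_recl big_ord0 coef1 !mulr1 addr0.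
rewrite !big_cons /= {}IH; set P := \prod_(z <- s) _; set n := size s.
have sP : P`_n.+1 = 0.
  by rewrite nth_default // /P size_prod_XsubC.
rewrite mulrBl mul1r.
under [RHS]eq_bigr => m _ do rewrite mulrBl coefB coefXM coefCM mulrBl.
rewrite sumrB; congr (_ - _).
  rewrite [RHS]big_ord_recl /= mul0r add0r; apply: eq_bigr => m _.
  by rewrite /bump /= add1n subSS.
rewrite [RHS]big_ord_recr /= sP mulr0 mul0r addr0 mulr_sumr; apply: eq_bigr => m _.
by rewrite subSn -1?ltnS // exprS; ring.
Qed.

Lemma det_powersE (R : comNzRingType) (y : 'I_l -> R) :
  \det (\matrix_(i < l, m < l) y i ^+ m) = \prod_(i < l) \prod_(j < l | (i < j)%N) (y j - y i).
Proof.
rewrite -det_tr -[LHS](_ : \det (Vandermonde l (\row_j y j)) = _).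
  rewrite det_Vandermonde; apply: eq_bigr => i _; apply: eq_bigr => j _.
  by rewrite !mxE.
by congr (\det _); apply/matrixP => i j; rewrite !mxE.
Qed.

Lemma alternantE (R : comNzRingType) (y : 'I_l -> R) :
  alternant y = (-1) ^+ (perm (@rev_ord_inj l)) * \det (\matrix_(i < l, m < l) y i ^+ m).
Proof.
rewrite -odd_permV -det_perm mulrC -det_mulmx; congr (\det _); rewrite -col_permE.
apply/matrixP => i j; rewrite !mxE permE /=; congr (_ ^+ _).
by rewrite /stair -subn1 -subnDA add1n.
Qed.

(** Cauchy's determinant of 1 / (1 - x_i y_j) with the denominators cleared in each row. The matrix
    is the alternant matrix of x times the coefficient matrix C of the products of X - y_k over k !=
    j. Evaluation at the y_i makes U C diagonal, with determinant (det U)^2 up to sign, and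
    regularity cancels one factor det U. *)
Lemma cauchy_det x y :
  GRing.lreg (\prod_(i < l) \prod_(j < l | (i < j)%N) (y j - y i)) -> exists e : bool,
  \det (\matrix_(i < l, j < l) \prod_(k < l | k != j) (1 - x i * y k)) =
  (-1) ^+ e * (alternant x * alternant y).
Proof.
move=> reg; pose ys j := [seq y k | k <- enum 'I_l & k != j].
pose Q j := \prod_(z <- ys j) ('X - z%:P).
pose C := \matrix_(m < l, j < l) (Q j)`_m.
pose U := \matrix_(i < l, m < l) y i ^+ m.
have sys j : size (ys j) = l.-1.
  have <- : (\sum_(k < l | k != j) 1 = l.-1)%N by rewrite sum1_card cardC1 card_ord.
  by rewrite size_map size_filter -sum1_count big_enum_cond.
have -> : \matrix_(i < l, j < l) \prod_(k < l | k != j) (1 - x i * y k) =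
    (\matrix_(i < l, j < l) x i ^+ stair j) *m C.
  apply/matrixP => i j; rewrite !mxE.
  have := prod_subC_rev (ys j) (x i); rewrite big_map big_filter big_enum_cond /= => ->.
  have l0 : (size (ys j)).+1 = l by rewrite sys prednK // (leq_ltn_trans _ (ltn_ord j)).
  rewrite [RHS](eq_bigr (fun m : 'I_l => (Q j)`_m * x i ^+ (size (ys j) - m))); last first.
    by move=> m _; rewrite !mxE mulrC sys.
  by rewrite -(big_mkord xpredT (fun m => (Q j)`_m * x i ^+ (size (ys j) - m))) l0 big_mkord.
rewrite det_mulmx -/(alternant x).
have UC : U *m C = diag_mx (\row_i \prod_(k < l | k != i) (y i - y k)).
  apply/matrixP => i j; rewrite !mxE.
  have -> : \sum_(k < l) U i k * C k j = (Q j).[y i].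
    rewrite (@horner_coef_wide _ l).
      by apply: eq_bigr => m _; rewrite !mxE mulrC.
    by rewrite /Q size_prod_XsubC sys; case: (l) j => [[]|].
  rewrite /Q big_map big_filter big_enum_cond /= horner_prod.
  under eq_bigr => k _ do rewrite hornerXsubC.
  case: eqVneq => [->|ij]; first by rewrite mulr1n.
  by rewrite mulr0n (bigD1 i) //= subrr mul0r.
have dU : \det U = \prod_(i < l) \prod_(j < l | (i < j)%N) (y j - y i) by exact: det_powersE.
have [e dC] : exists e : bool, \det C = (-1) ^+ e * \det U.
  pose E := (\sum_(i < l) \sum_(j < l | (i < j)%N) 1)%N.
  exists (odd E); rewrite -dU in reg; apply: reg; rewrite -det_mulmx UC det_diag signr_odd.
  transitivity (\prod_(i < l) ((\prod_(k < l | (i < k)%N) (y i - y k)) *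
      (\prod_(k < l | (k < i)%N) (y i - y k)))).
    apply: eq_bigr => i _; rewrite mxE (bigID (fun k : 'I_l => (i < k)%N)) /=.
    congr (_ * _); apply: eq_bigl => k; rewrite -val_eqE /=; case: (ssrnat.ltngtP i k) => //.
  rewrite big_split /= [X in _ * X](exchange_big_dep xpredT) //= -dU mulrC; congr (_ * _).
  rewrite dU /E -prodrXr -big_split /=; apply: eq_bigr => i _.
  rewrite -prodrXr -big_split /=; apply: eq_bigr => j _; ring.
exists (e (+) perm (@rev_ord_inj l)).
rewrite dC [alternant y]alternantE -/U signr_addb.
have uu : (-1) ^+ perm (@rev_ord_inj l) * (-1) ^+ perm (@rev_ord_inj l) = 1 :> A.
  by rewrite -signr_addb addbb.
move: (_ ^+ perm _) uu => u uu.
transitivity (u * u * (alternant x * ((-1) ^+ e * \det U))); last by ring.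
by rewrite uu mul1r.
Qed.

End CauchyDeterminant.

(** In the term of w in the determinant, the factors 1 - z i k cancel every geometric series but
    those at k = w i, up to the truncation errors z ^+ M. *)
Lemma prod_geometric (R : comNzRingType) l (z : 'I_l -> 'I_l -> R) (w : 'I_l -> 'I_l) M :
  (\prod_i \prod_(k < l | k != w i) (1 - z i k)) *
    (\prod_i \prod_k \sum_(j < M) z i k ^+ j) =
  (\prod_i \prod_(k < l | k != w i) (1 - z i k ^+ M)) * \prod_i \sum_(j < M) z i (w i) ^+ j.
Proof.
have geo u : (1 - u) * \sum_(j < M) u ^+ j = 1 - u ^+ M :> R.
  by rewrite -[RHS]opprB subrX1 -mulNr opprB.
rewrite -!big_split /=; apply: eq_bigr => i _.
rewrite [X in _ * X = _](bigD1 (w i)) //= mulrCA mulrC -big_split /=; congr (_ * _).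
by apply: eq_bigr => k _; exact: geo.
Qed.

Lemma lreg_prod (R : comNzRingType) (I : Type) (r : seq I) (P : pred I) (u : I -> R) :
  (forall i, P i -> GRing.lreg (u i)) -> GRing.lreg (\prod_(i <- r | P i) u i).
Proof. by move=> hu; apply: big_ind => //; [exact: lreg1 | exact: lregM]. Qed.

Lemma mpoly_lreg (R : idomainType) l k (p : {mpoly {mpoly R[l]}[k]}) : p != 0 -> GRing.lreg p.
Proof. by move=> p0; apply/lregP. Qed.

Lemma sign_swap (R : pzRingType) (e : bool) (a b : R) : a = (-1) ^+ e * b -> b = (-1) ^+ e * a.
Proof. by move=> ->; rewrite mulrA -signr_addb addbb mul1r. Qed.

Section LowPart.
Variables (R : comNzRingType) (l : nat) (L : 'X_{1..l}).

(* Polynomials without monomials dividing 'X_[L]; they form an ideal. *)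
Definition high (p : {mpoly R[l]}) : Prop := forall m, (m <= L)%MM -> p@_m = 0.

Lemma highD p q : high p -> high q -> high (p + q).
Proof. by move=> hp hq m mL; rewrite mcoeffD hp // hq // addr0. Qed.

Lemma highM p q : high p -> high (p * q).
Proof.
move=> hp m mL; rewrite mcoeffM big1 // => k /eqP e.
rewrite hp ?mul0r //; apply: lepm_trans mL.
apply/mnm_lepP => i; have /(congr1 (fun m' : 'X_{1..l} => m' i)) := e.
by rewrite mnmDE => ->; exact: leq_addr.
Qed.

Lemma highXn i N c : (L i < N)%N -> high (('X_i * c) ^+ N).
Proof.
move=> LN; rewrite exprMn_comm; last exact: mulrC.
apply: highM => m /mnm_lepP mL; rewrite mcoeffXn.
case: eqP => // e; exfalso; have := mL i; rewrite -e mulmnE mnm1E eqxx mul1n leqNgt LN //.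
Qed.

Lemma high_prod1 (I : Type) (s : seq I) (P : pred I) (u : I -> {mpoly R[l]}) :
  (forall i, P i -> high (u i - 1)) -> high (\prod_(i <- s | P i) u i - 1).
Proof.
move=> hu; apply: (big_ind (fun p => high (p - 1))) => //.
- by rewrite subrr => m _; rewrite mcoeff0.
- move=> p q hp hq; have -> : p * q - 1 = (p - 1) * q + (q - 1) by ring.
  by apply: highD => //; apply: highM.
Qed.

End LowPart.

Section Norm.
Variables (l n : nat) (L : 'X_{1..l}).
Hypothesis L_inj : injective L.
Hypothesis sumL : (\sum_i L i = n + \sum_(i < l) stair i)%N.
Local Notation P := {mpoly algC[l]}.
Local Notation S := {mpoly {mpoly algC[l]}[l]}.
Local Notation x := (fun i => 'X_i : S).
Local Notation y := (fun i => ('X_i : P)%:MP : S).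

Definition fixed_sum (s : 'S_n) : P := \sum_(f : {ffun 'I_n -> 'I_l} | word_fixed f s) \prod_i 'X_(f i).

Definition frobenius (s : 'S_n) : algC := (alternant (fun i => 'X_i : P) * fixed_sum s)@_L.

Lemma alternant_mpoly (R : comNzRingType) : alternant (fun i => 'X_i : {mpoly R[l]}) =
  \sum_(w : 'S_l) (-1) ^+ w * 'X_[ [multinom stair (w i) | i < l] ].
Proof.
rewrite /alternant /determinant; apply: eq_bigr => w _; congr (_ * _).
by rewrite mpolyXE_id; apply: eq_bigr => i _; rewrite mxE mnmE.
Qed.

(** Doubling the variables turns a product of coefficients into one coefficient of a polynomial in x
    over polynomials in y, the setting of Cauchy's identity. *)
Lemma mcoeff_tensor (p q : P) (m : 'X_{1..l}) :
  p@_m * q@_m = ((map_mpoly (@mpolyC l algC) p * q%:MP)@_m)@_m.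
Proof. by rewrite [map_mpoly _ _ * _]mulrC mcoeffCM mcoeff_map_mpoly [q * _]mulrC mcoeffCM. Qed.

(** Two words fixed by s are one fixed word over pairs of letters, so the orbit count
    [sum_fixed_words] will apply to the alphabet of pairs. *)
Lemma frobenius_sqr (s : 'S_n) : frobenius s ^+ 2 =
  ((alternant x * alternant y *
    \sum_(f : {ffun 'I_n -> 'I_l * 'I_l} | word_fixed f s) \prod_i (x (f i).1 * y (f i).2))@_L)@_L.
Proof.
rewrite expr2 mcoeff_tensor; apply: (congr1 (fun p : S => (p@_L)@_L)).
rewrite !rmorphM /= mulrACA !rmorph_alternant.
have -> : map_mpoly (@mpolyC l algC) \o (fun i => 'X_i : P) = x.
  by apply: funext => i /=; rewrite map_mpolyX.
have -> : mpolyC l (R:=P) \o (fun i => 'X_i : P) = y by [].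
apply: (congr1 (fun p : S => _ * p)).
rewrite /fixed_sum !rmorph_sum /= big_distrlr /= pair_big /=.
pose h (u : {ffun 'I_n -> 'I_l} * {ffun 'I_n -> 'I_l}) : {ffun 'I_n -> 'I_l * 'I_l} :=
  [ffun i => (u.1 i, u.2 i)].
rewrite [RHS](reindex h) /=; last first.
  exists (fun f => ([ffun i => (f i).1], [ffun i => (f i).2])) => [[f g] _|f _].
    by congr (_, _); apply/ffunP => i; rewrite !ffunE.
  by apply/ffunP => i; rewrite !ffunE; case: (f i).
apply: eq_big => [[f g]|[f g] _] /=.
  rewrite /word_fixed; apply/andP/eqP => [[/eqP/ffunP ef /eqP/ffunP eg]|/ffunP e].
    by apply/ffunP => i; have := ef i; have := eg i; rewrite !ffunE => -> ->.
  by split; apply/eqP/ffunP => i; have := e i; rewrite !ffunE => -[].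
rewrite !rmorph_prod -big_split /=; apply: eq_bigr => i _.
by rewrite ffunE /= map_mpolyX.
Qed.

Let N := (n + \sum_i L i)%N.
Let LN i : (L i <= N)%N.
Proof. by rewrite /N (bigD1 i) //= addnCA leq_addr. Qed.
Local Notation z := (fun t : 'I_l * 'I_l => x t.1 * y t.2).
Local Notation geo t := (\sum_(k < N.+1) z t ^+ k).

Lemma monomial_prod (R : comNzRingType) (I : finType) (v : I -> 'I_l) (m : I -> nat) :
  exists M, \prod_i 'X_(v i) ^+ m i = 'X_[M] :> {mpoly R[l]} /\ mdeg M = (\sum_i m i)%N.
Proof.
exists (\sum_i U_(v i) *+ m i)%MM; split.
  rewrite (big_morph _ (@mpolyXD l R) (mpolyX0 l R)).
  by apply: eq_bigr => i _; rewrite mpolyXn.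
by rewrite mdeg_sum; apply: eq_bigr => i _; rewrite mdegMn mdeg1 mul1n.
Qed.

Lemma mdeg_stair (w : 'S_l) : mdeg [multinom stair (w i) | i < l] = (\sum_(i < l) stair i)%N.
Proof.
by rewrite mdegE [RHS](reindex_inj (@perm_inj _ w)); apply: eq_bigr => i _; rewrite mnmE.
Qed.

Lemma mdegL : mdeg L = (n + \sum_(i < l) stair i)%N.
Proof. by rewrite mdegE. Qed.

(** By homogeneity and [sumL]. It removes the degree restriction from the orbit count, after which
    the sum factors into geometric series. *)
Lemma alternant_degree (m : {ffun 'I_l * 'I_l -> 'I_N.+1}) : (\sum_t m t)%N != n ->
  (alternant x * alternant y * \prod_t z t ^+ m t)@_L = 0.
Proof.
move=> mn; have -> : alternant y = (alternant (fun i => 'X_i : P))%:MP.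
  by rewrite rmorph_alternant.
have -> : \prod_t z t ^+ m t = (\prod_t 'X_(t.2) ^+ m t : P)%:MP * \prod_t 'X_(t.1) ^+ m t.
  rewrite rmorph_prod -big_split /=; apply: eq_bigr => t _.
  by rewrite exprMn mulrC rmorphXn.
have [M [-> dM]] := monomial_prod P (fun t : 'I_l * 'I_l => t.1) (fun t => m t : nat).
rewrite -[alternant x * _]mulrC -mulrA [alternant x * _]mulrCA !mcoeffCM.
suff -> : ((alternant x : S) * 'X_[M])@_L = 0 by rewrite !mulr0.
rewrite (alternant_mpoly P) mulr_suml raddf_sum /= big1 // => w _.
have -> : (-1) ^+ w * 'X_[ [multinom stair (w i) | i < l]] * 'X_[M] =
   ((-1) ^+ w)%:MP * 'X_[ [multinom stair (w i) | i < l] + M] :> S.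
  by rewrite mpolyXD mulrA rmorph_sign.
rewrite mcoeffCM mcoeffX; case: eqP => [e|_]; last by rewrite mulr0.
case/eqP: mn; have /(congr1 mdeg) := e.
by rewrite mdegD mdeg_stair dM mdegL addnC => /addIn.
Qed.

(** The exponents of x must equal L, and those of y are then L permuted by w; as L has distinct
    entries, only w = 1 contributes. *)
Lemma diagonal_coef :
  ((\sum_(w : 'S_l) (-1) ^+ w * \prod_i geo (i, w i))@_L)@_L = 1.
Proof.
have coefw (w : 'S_l) : (((-1) ^+ w * \prod_i geo (i, w i) : S)@_L)@_L = (w == 1%g)%:R.
  have -> : (-1) ^+ w = (((-1) ^+ w)%:MP)%:MP :> S by rewrite !rmorph_sign.
  rewrite !mcoeffCM bigA_distr_bigA /=.
  have prodE (k : {ffun 'I_l -> 'I_N.+1}) : \prod_i z (i, w i) ^+ k i =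
      'X_[ [multinom k ((w^-1)%g i) : nat | i < l] ]%:MP * 'X_[ [multinom k i : nat | i < l] ] :> S.
    rewrite !mpolyXE_id rmorph_prod [X in _ = X * _](reindex_inj (@perm_inj _ w)) -big_split /=.
    by apply: eq_bigr => i _; rewrite !mnmE permK exprMn mulrC rmorphXn.
  rewrite !raddf_sum /=.
  pose k0 : {ffun 'I_l -> 'I_N.+1} := [ffun i => inord (L i)].
  have k0E i : k0 i = L i :> nat by rewrite ffunE inordK // ltnS.
  rewrite (bigD1 k0) //= [X in _ + X]big1 ?addr0 => [|k /eqP kk0].
    rewrite prodE mcoeffCM mcoeffX.
    have -> : [multinom (k0 i : nat) | i < l] = L by apply/mnmP => i; rewrite mnmE k0E.
    rewrite eqxx mulr1 mcoeffX; case: (eqVneq w 1%g) => [->|w1].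
      rewrite invg1; have -> : [multinom (k0 ((1%g : 'S_l) i) : nat) | i < l] = L.
        by apply/mnmP => i; rewrite mnmE perm1 k0E.
      by rewrite odd_perm1 expr0 eqxx mulr1.
    case: eqP => [/mnmP e|_]; last by rewrite mulr0.
    case/eqP: w1; apply/eqP; rewrite -invg_eq1; apply/eqP/permP => i; rewrite perm1.
    by apply: L_inj; have := e i; rewrite mnmE k0E.
  rewrite prodE mcoeffCM mcoeffX; case: eqP => [/mnmP e|_]; last by rewrite mulr0 mcoeff0.
  by case: kk0; apply/ffunP => i; apply: val_inj; have := e i; rewrite /= k0E mnmE.
rewrite !raddf_sum /= (eq_bigr _ (fun w _ => coefw w)) (bigD1 1%g) //= eqxx big1 ?addr0 //.
by move=> w /negPf ->.
Qed.

Lemma sum_frobenius_sqr : exists e : bool,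
  \sum_(s : 'S_n) frobenius s ^+ 2 = (-1) ^+ e * n`!%:R.
Proof.
have y_inj : injective y.
  move=> i j /(congr1 (mcoeff 0%MM)); rewrite !mcoeffC eqxx !mulr1.
  move=> /(congr1 (fun p : P => p@_U_(i))); rewrite !mcoeffXU eqxx eq_sym.
  by case: eqP => // _ /eqP; rewrite oner_eq0.
have reg : GRing.lreg (\prod_(i < l) \prod_(j < l | (i < j)%N) (y j - y i) : S).
  apply: lreg_prod => i _; apply: lreg_prod => j ij; apply: mpoly_lreg.
  by rewrite subr_eq0 (inj_eq y_inj) -val_eqE gtn_eqF.
have [e ce] := cauchy_det x reg; exists e.
under eq_bigr do rewrite frobenius_sqr.
rewrite -!raddf_sum -mulr_sumr (@sum_fixed_words n _ S z N (leq_addr _ n)).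
rewrite mulrCA mulr_natl !raddfMn [LHS]/= -[LHS]mulr_natr; congr (_ * _).
transitivity ((alternant x * alternant y * \sum_(m : {ffun 'I_l * 'I_l -> 'I_N.+1})
    \prod_t z t ^+ m t)@_L@_L).
  rewrite [in RHS](bigID (fun m : {ffun 'I_l * 'I_l -> 'I_N.+1} => (\sum_t m t)%N == n)) /=.
  rewrite mulrDr mcoeffD; set X := (_ * \sum_(m | ~~ _) _)@_L.
  have -> : X = 0; last by rewrite addr0.
  by rewrite /X mulr_sumr raddf_sum /= big1 // => m; exact: alternant_degree.
rewrite -(bigA_distr_bigA (fun t (k : 'I_N.+1) => z t ^+ k)).
have -> : alternant x * alternant y = (-1) ^+ e *
   \det (\matrix_(i < l, j < l) \prod_(k < l | k != j) (1 - x i * y k)).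
  exact: sign_swap ce.
have -> : (-1) ^+ e = (((-1) ^+ e)%:MP)%:MP :> S by rewrite !rmorph_sign.
rewrite -mulrA !mcoeffCM -[RHS]mulr1; congr (_ * _); rewrite -diagonal_coef.
congr (_@__); apply/eqP; rewrite -subr_eq0 -mcoeffB; apply/eqP.
(* The identity holds only modulo [high L]: since N bounds the entries of L, the truncation errors z
   ^+ N.+1 lie in that ideal. *)
suff hi : high L (\det (\matrix_(i < l, j < l) \prod_(k < l | k != j) (1 - x i * y k)) *
     (\prod_t geo t) - \sum_(w : 'S_l) (-1) ^+ w * \prod_i geo (i, w i)).
  by apply: hi; apply/mnm_lepP => i.
rewrite /determinant mulr_suml -sumrB.
apply: (big_ind (high L)) => [m _|p q|w _]; [by rewrite mcoeff0|exact: highD|].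
have -> : \prod_t geo t = \prod_(i < l) \prod_(k < l) geo (i, k) :> S by rewrite pair_bigA.
under eq_bigr do rewrite mxE.
rewrite -mulrA (prod_geometric (fun i k => x i * y k) w) mulrCA.
rewrite -[X in _ - X]mul1r -mulrBl.
apply: highM; apply: high_prod1 => i _; apply: high_prod1 => k _ m mL.
have -> : 1 - z (i, k) ^+ N.+1 - 1 = - (z (i, k) ^+ N.+1) by ring.
by rewrite mcoeffN (@highXn _ _ L i N.+1 _ (LN i)) ?oppr0.
Qed.

End Norm.

(** * Signed pairings and the James-Kerber constituent *)

Section Segments.
Variable k : nat.
Implicit Types A : {set 'I_k}.

Lemma card_below A : (2 * \sum_(i in A) #|[set j in A | (j < i)%N]| + #|A| = #|A| ^ 2)%N.
Proof.
have e1 : (\sum_(i in A) #|[set j in A | (j < i)%N]| = \sum_(i in A) \sum_(j in A) (j < i))%N.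
  apply: eq_bigr => i _; rewrite -sum1_card big_mkcond [RHS]big_mkcond.
  by apply: eq_bigr => j _; rewrite inE; case: (j \in A); case: (j < i)%N.
have e2 : (#|A| ^ 2 = \sum_(i in A) \sum_(j in A) ((j < i) + (i < j) + (i == j)))%N.
  rewrite -mulnn -sum_nat_const; apply: eq_bigr => i _; rewrite -sum1_card.
  by apply: eq_bigr => j _; rewrite -val_eqE; case: (ssrnat.ltngtP i j).
rewrite e1 e2.
under [RHS]eq_bigr do rewrite !big_split /=.
rewrite !big_split /= mulSn mul1n; congr (_ + _ + _)%N; first by rewrite exchange_big.
rewrite -sum1_card; apply: eq_bigr => i iA.
by rewrite (bigD1 i) //= eqxx big1 // => j /andP[_ /negPf]; rewrite eq_sym => ->.
Qed.

Lemma sum_ord_lt c : (c <= k)%N -> (\sum_(j < k | (j < c)%N) 1 = c)%N.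
Proof. by move=> ck; rewrite -(big_ord_widen k (fun=> 1%N) ck) sum1_card card_ord. Qed.

Lemma card_belowE A (i : 'I_k) :
  #|[set j in A | (j < i)%N]| = (\sum_(j < k | (j < i)%N) (j \in A))%N.
Proof.
rewrite -sum1_card big_mkcond [RHS]big_mkcond; apply: eq_bigr => j _.
by rewrite inE; case: (j \in A); case: (j < i)%N.
Qed.

Lemma card_below_le A (i : 'I_k) : (#|[set j in A | (j < i)%N]| <= i)%N.
Proof.
rewrite card_belowE -[X in (_ <= X)%N](sum_ord_lt (ltnW (ltn_ord i))).
by apply: leq_sum => j _; case: (j \in A).
Qed.

Lemma card_below_eq A (i : 'I_k) :
  (forall j : 'I_k, (j < i)%N -> j \in A) -> #|[set j in A | (j < i)%N]| = i.
Proof.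
move=> h; rewrite card_belowE -[RHS](sum_ord_lt (ltnW (ltn_ord i))).
by apply: eq_bigr => j /h ->.
Qed.

(** A set of c numbers has sum at least 0 + ... + (c - 1), because an element i has at most i
    elements below it. Equality characterises initial segments. *)
Lemma card_sqr_le A : (#|A| ^ 2 <= 2 * \sum_(i in A) i + #|A|)%N.
Proof.
rewrite -card_below leq_add2r leq_mul2l /=; apply: leq_sum => i _; exact: card_below_le.
Qed.

Lemma card_sqr_segment A : (forall i j : 'I_k, i \in A -> (j < i)%N -> j \in A) ->
  (#|A| ^ 2 = 2 * \sum_(i in A) i + #|A|)%N.
Proof.
move=> h; rewrite -card_below; congr (2 * _ + _)%N; apply: eq_bigr => i iA.
by apply: card_below_eq => j; exact: h.
Qed.

Lemma card_sqr_eq A : (#|A| ^ 2 = 2 * \sum_(i in A) i + #|A|)%N ->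
  A = [set i : 'I_k | (i < #|A|)%N].
Proof.
move=> e.
have down (i j : 'I_k) : i \in A -> (j < i)%N -> j \in A.
  move=> iA ji; apply: contraT => jA.
  have : (\sum_(i in A) #|[set j in A | (j < i)%N]| < \sum_(i in A) i)%N.
    rewrite (bigD1 i) //= [X in (_ < X)%N](bigD1 i) //= -addSn leq_add //; last first.
      by apply: leq_sum => i' _; exact: card_below_le.
    rewrite card_belowE -[X in (_ < X)%N](sum_ord_lt (ltnW (ltn_ord i))).
    rewrite (bigD1 j) //= [X in (_ < X)%N](bigD1 j) //= (negPf jA) add0n add1n ltnS.
    by apply: leq_sum => j' _; case: (j' \in A).
  by move: (card_below A); rewrite e; lia.
have sub : A \subset [set i : 'I_k | (i < #|A|)%N].
  apply/fintype.subsetP => i iA; rewrite inE -(card_below_eq (A := A) (i := i)); last first.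
    by move=> j; exact: down.
  apply: proper_card; apply/properP; split; first by apply/fintype.subsetP => j; rewrite inE => /andP[].
  by exists i => //; rewrite inE ltnn andbF.
apply/eqP; rewrite eqEcard sub /=.
have ck : (#|A| <= k)%N by rewrite -[X in (_ <= X)%N](card_ord k) max_card.
by rewrite -sum1_card (eq_bigl (fun i : 'I_k => (i < #|A|)%N)) ?sum_ord_lt // => i; rewrite inE.
Qed.

End Segments.

Section Stairs.
Variables (l : nat) (la : 'I_l -> nat).
Hypothesis la_dec : forall i j : 'I_l, (i <= j)%N -> (la j <= la i)%N.

(* By slicing la into horizontal layers. *)
Lemma rearrangement (w : 'S_l) : (\sum_i la i * i <= \sum_i la i * w i)%N.
Proof.
pose B := (\sum_i la i)%N.
have layers (c : 'I_l -> nat) : (\sum_i la i * c i = \sum_(t < B) \sum_(i | (t < la i)%N) c i)%N.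
  transitivity (\sum_i \sum_(t < B | (t < la i)%N) c i)%N.
    apply: eq_bigr => i _; rewrite -{1}(@sum_ord_lt B (la i)) ?big_distrl /=.
      by apply: eq_bigr => t _; rewrite mul1n.
    by rewrite /B (bigD1 i) //= leq_addr.
  by rewrite (exchange_big_dep xpredT).
rewrite (layers (fun i => i)) (layers (fun i => w i)); apply: leq_sum => t _.
(* This layer is an initial segment and its image under w has the same size, hence no smaller
   sum. *)
pose A := [set i | (t < la i)%N].
have := @card_sqr_segment l A; have := card_sqr_le (w @: A).
rewrite card_imset; last exact: perm_inj.
have -> : (\sum_(i in w @: A) i = \sum_(i | (t < la i)%N) w i)%N.
  rewrite big_imset /=; last by move=> i j _ _; exact: perm_inj.
  by apply: eq_bigl => i; rewrite inE.
have -> : (\sum_(i in A) i = \sum_(i | (t < la i)%N) i)%N.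
  by apply: eq_bigl => i; rewrite inE.
move=> h1 h2; have {}h2 : (#|A| ^ 2 = 2 * (\sum_(i | (t < la i)%N) i) + #|A|)%N.
  apply: h2 => i j; rewrite !inE => ti ji; apply: leq_trans ti (la_dec _); exact: ltnW.
by move: h1; rewrite h2 leq_add2r leq_mul2l.
Qed.

(** Here m i - la i = w i - i, so m_i^2 - la_i^2 = 2 la_i (w i - i) + (w i - i)^2. The first terms
    sum to at least 0 by [rearrangement], the second to a positive number. *)
Lemma stair_shift_sqr (w : 'S_l) (m : 'I_l -> nat) : w != 1%g ->
  (forall i, m i + stair (w i) = la i + stair i)%N ->
  (\sum_i la i ^ 2 < \sum_i m i ^ 2)%N.
Proof.
move=> w1 mE.
have mE' i : (m i + i = la i + w i)%N.
  have := mE i; rewrite /stair; have := ltn_ord i; have := ltn_ord (w i); lia.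
have sq i : (la i ^ 2 + (la i * w i + la i * w i) + (w i != i) <=
    m i ^ 2 + (la i * i + la i * i))%N.
  rewrite -[w i != i]/(_) -val_eqE /=; have := mE' i.
  move: (m i) (la i) (nat_of_ord (w i)) (nat_of_ord i) => a b c d e.
  have [cd|cd] := eqVneq c d; first by rewrite /= addn0 cd; nia.
  by rewrite /= addn1; nia.
have : (\sum_i (la i ^ 2 + (la i * w i + la i * w i) + (w i != i)) <=
    \sum_i (m i ^ 2 + (la i * i + la i * i)))%N by apply: leq_sum.
rewrite !big_split /=; have := rearrangement w.
have : (0 < \sum_i (w i != i))%N.
  rewrite lt0n sum_nat_eq0 negb_forall; apply: contraT; rewrite negb_exists => /forallP h.
  by case/eqP: w1; apply/permP => i; have := h i; rewrite perm1 /= eqb0 !negbK => /eqP.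
move: (\sum_i _)%N (\sum_i _)%N (\sum_i _)%N (\sum_i _)%N (\sum_i _)%N => p q r t u; lia.
Qed.

End Stairs.

(** * Repetition-free pairs of words and the diagram of la *)

Section PairWords.
Variables (n l k : nat) (la : 'I_l -> nat).
Hypothesis sum_la : (\sum_r la r = n)%N.
Hypothesis la_le : forall r, (la r <= k)%N.
Local Notation col := (fun j : 'I_k => (\sum_(r < l) (j < la r))%N).
Implicit Types F : {ffun 'I_n -> 'I_l * 'I_k}.

Definition word1 F : {ffun 'I_n -> 'I_l} := [ffun i => (F i).1].
Definition word2 F : {ffun 'I_n -> 'I_k} := [ffun i => (F i).2].

Lemma card_contentE (T : finType) (f : {ffun 'I_n -> T}) x : content f x = #|[set i | f i == x]|.
Proof.
rewrite ffunE -sum1_card [RHS]big_mkcond; apply: eq_bigr => i _.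
by rewrite inE; case: (f i == x).
Qed.

(** Weigh each cell of column j by 2 j + 1 and sum over the diagram by rows and by columns. *)
Lemma sum_sqr_la : (\sum_r la r ^ 2 = 2 * (\sum_(j < k) col j * j) + n)%N.
Proof.
have e r : (la r ^ 2 = 2 * (\sum_(j < k) (j < la r) * j) + la r)%N.
  pose A := [set j : 'I_k | (j < la r)%N].
  have cA : #|A| = la r.
    by rewrite -[RHS](sum_ord_lt (la_le r)) -sum1_card; apply: eq_bigl => j; rewrite inE.
  have := @card_sqr_segment k A; rewrite cA => ->; last first.
    by move=> i j; rewrite !inE => h1 h2; exact: ltn_trans h1.
  congr (2 * _ + _)%N; rewrite big_mkcond; apply: eq_bigr => j _.
  by rewrite inE; case: ifP; rewrite ?mul1n.
under eq_bigr do rewrite e.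
rewrite big_split /= sum_la; congr (_ + _)%N; rewrite -big_distrr /=; congr (2 * _)%N.
by rewrite exchange_big; apply: eq_bigr => j _; rewrite big_distrl.
Qed.

Section OnePair.
Variables (F : {ffun 'I_n -> 'I_l * 'I_k}).
Hypothesis F_inj : injective F.
Hypothesis F2 : forall j, content (word2 F) j = col j.
Local Notation m := (content (word1 F)).
Local Notation J r := [set (F i).2 | i in [set i | (F i).1 == r]].

Lemma card_J r : #|J r| = m r.
Proof.
rewrite card_contentE card_in_imset.
  by apply: eq_card => i; rewrite !inE ffunE.
move=> i j; rewrite !inE => /eqP i1 /eqP j1 e2; apply: F_inj.
by apply/eqP; rewrite -pair_eqE /= /pair_eq i1 j1 e2 !eqxx.
Qed.

Lemma sum_J : (\sum_r (2 * (\sum_(j in J r) j) + #|J r|) = \sum_r la r ^ 2)%N.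
Proof.
rewrite big_split /= (eq_bigr _ (fun r _ => card_J r)) sum_content sum_sqr_la.
congr (_ + _)%N; rewrite -big_distrr /=; congr (2 * _)%N.
transitivity (\sum_i (F i).2)%N.
  rewrite [RHS](partition_big (fun i => (F i).1) xpredT) //=; apply: eq_bigr => r _.
  rewrite big_imset /=; first by apply: eq_bigl => i; rewrite inE.
  move=> i j; rewrite !inE => /eqP i1 /eqP j1 e2; apply: F_inj.
  by apply/eqP; rewrite -pair_eqE /= /pair_eq i1 j1 e2 !eqxx.
rewrite (partition_big (fun i => (F i).2) xpredT) //=; apply: eq_bigr => j _.
rewrite -F2 card_contentE -sum_nat_const; apply: eq_big => i; first by rewrite inE ffunE.
by move=> /eqP ->.
Qed.

(** Distinct pairs with first letter r have distinct second letters, so [card_sqr_le] applies to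
    each r; the total weight of the second letters is that of the diagram. This takes the place of a
    dominance order argument. *)
Lemma pair_sqr_le : (\sum_r m r ^ 2 <= \sum_r la r ^ 2)%N.
Proof.
by rewrite -sum_J; apply: leq_sum => r _; rewrite -card_J; exact: card_sqr_le.
Qed.

(** With m = la the row inequalities sum to an equality, so each is an equality and each row is an
    initial segment. *)
Lemma pair_segment : m =1 la -> forall i, ((F i).2 < la (F i).1)%N.
Proof.
move=> ml i; set r := (F i).1.
have eJ : (#|J r| ^ 2 = 2 * (\sum_(j in J r) j) + #|J r|)%N.
  apply/eqP; rewrite eqn_leq card_sqr_le /= leqNgt; apply/negP => lt.
  have := sum_J; rewrite (bigD1 r) //= [X in _ = X -> _](bigD1 r) //=.
  have : (\sum_(r' < l | r' != r) la r' ^ 2 <=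
     \sum_(r' < l | r' != r) (2 * (\sum_(j in J r') j) + #|J r'|))%N.
    by apply: leq_sum => r' _; rewrite -ml -card_J; exact: card_sqr_le.
  move: lt; rewrite -ml -card_J.
  move: (\sum_(r' < l | _) _)%N (\sum_(r' < l | _) _)%N (2 * _ + _)%N (_ ^ 2)%N => a b c d.
  lia.
have : (F i).2 \in J r by apply/imsetP; exists i => //; rewrite inE.
by rewrite (card_sqr_eq eJ) inE card_J ml.
Qed.

End OnePair.

(** By [pair_segment], these F are exactly the bijections from the n positions onto the cells of the
    diagram. *)
Lemma card_injective_pairs :
  #|[set F : {ffun 'I_n -> 'I_l * 'I_k} | [&& injectiveb F, [forall r, content (word1 F) r == la r]
       & [forall j, content (word2 F) j == col j]]]| = n`!.
Proof.
pose D := [set p : 'I_l * 'I_k | (p.2 < la p.1)%N].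
have sD (P : pred ('I_l * 'I_k)) : #|[set p in D | P p]| =
    (\sum_r \sum_(j < k) ((j < la r) && P (r, j)))%N.
  rewrite -sum1_card pair_big /= big_mkcond; apply: eq_bigr => -[r j] _ /=.
  by rewrite !inE /=; case: (_ && _).
have cD : #|D| = n.
  have -> : D = [set p in D | true] by apply/setP => p; rewrite !inE andbT.
  rewrite sD -[RHS]sum_la; apply: eq_bigr => r _; rewrite -[RHS](sum_ord_lt (la_le r)).
  by rewrite [RHS]big_mkcond; apply: eq_bigr => j _; rewrite andbT; case: ltnP.
rewrite -ffactnn -[X in X ^_ _]cD -[X in _ ^_ X]card_ord -card_inj_ffuns_on.
apply: eq_card => F; rewrite !inE.
apply/and3P/andP => [[/injectiveP inj /forallP h1 /forallP h2]|[/ffun_onP FD /injectiveP inj]].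
  split; last exact/injectiveP.
  apply/ffun_onP => i; rewrite inE; apply: pair_segment => // [j|r]; exact/eqP.
have FT : F @: [set: 'I_n] = D.
  apply/eqP; rewrite eqEcard card_imset // cardsT card_ord cD leqnn andbT.
  by apply/fintype.subsetP => _ /imsetP[i _ ->]; exact: FD.
have cF (P : pred ('I_l * 'I_k)) : #|[set i | P (F i)]| = #|[set p in D | P p]|.
  rewrite -(card_imset _ inj); apply: eq_card => p; rewrite inE -FT.
  apply/imsetP/andP => [[i iP ->]|[/imsetP[i _ ->] Pp]].
    by rewrite inE in iP; rewrite iP imset_f ?inE.
  by exists i; rewrite ?inE.
split; first exact/injectiveP.
  apply/forallP => r; rewrite card_contentE.
  have -> : #|[set i | word1 F i == r]| = #|[set p in D | p.1 == r]|.
    by rewrite -cF; apply: eq_card => i; rewrite !inE ffunE.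
  rewrite sD (bigD1 r) //= [X in (_ + X)%N]big1 ?addn0; last first.
    by move=> r' /negPf r'r; rewrite big1 // => j _; rewrite r'r andbF.
  rewrite -[X in _ == X](sum_ord_lt (la_le r)) [X in _ == X]big_mkcond; apply/eqP/eq_bigr => j _.
  by rewrite eqxx andbT; case: ltnP.
apply/forallP => j; rewrite card_contentE.
have -> : #|[set i | word2 F i == j]| = #|[set p in D | p.2 == j]|.
  by rewrite -cF; apply: eq_card => i; rewrite !inE ffunE.
rewrite sD; apply/eqP/eq_bigr => r _; rewrite (bigD1 j) //= eqxx andbT.
by rewrite big1 ?addn0 // => j' /negPf j'j; rewrite j'j andbF.
Qed.

End PairWords.

Lemma block_word n sh : sumn sh = n -> exists f : {ffun 'I_n -> 'I_(size sh)},
  (forall k, f k = reshape_index sh k :> nat) /\ (forall i, content f i = nth 0%N sh i).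
Proof.
move=> sn.
have lt (k : 'I_n) : (reshape_index sh k < size sh)%N.
  by rewrite reshape_indexP // sn.
exists [ffun k => Ordinal (lt k)]; split=> [k|i]; first by rewrite ffunE.
rewrite card_contentE.
have lt' (c : 'I_(nth 0%N sh i)) : (flatten_index sh i c < n)%N.
  by rewrite -sn flatten_indexP.
rewrite -[RHS]card_ord -(card_imset _ (f := fun c => Ordinal (lt' c))); last first.
  move=> c d /(congr1 val) /= e; apply: val_inj.
  by rewrite /= -(@flatten_indexKr sh i c) // e flatten_indexKr.
apply: eq_card => k; rewrite inE ffunE -val_eqE /=.
apply/eqP/imsetP => [e|[c _ ->]]; last by rewrite /= flatten_indexKl.
have ok : (reshape_offset sh k < nth 0%N sh i)%N by rewrite -e reshape_offsetP // sn.
exists (Ordinal ok) => //; apply: val_inj => /=.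
by rewrite -e reshape_indexK.
Qed.

Section SignedPairing.
Variables (n : nat).

Lemma sgnE (s : 'S_n) : sgn n s = (-1) ^+ s.
Proof. by rewrite /sgn cfunE. Qed.

(** A repeated letter puts a transposition in the stabiliser, and multiplying by it flips every
    sign; without repetition the stabiliser is trivial. *)
Lemma sum_sign_stab (T : finType) (f : {ffun 'I_n -> T}) :
  \sum_(s : 'S_n | word_fixed f s) (-1) ^+ s = (injectiveb f)%:R :> algC.
Proof.
have [/injectiveP inj|/injectivePn[i [j ij fij]]] := boolP (injectiveb f).
  rewrite (big_pred1 1%g) ?odd_perm1 ?expr0 // => s; apply/eqP/eqP => [/ffunP e|->].
    by apply/permP => i; apply: inj; have := e i; rewrite ffunE perm1.
  exact: permute_word1.
have ft : permute_word f (tperm i j) = f.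
  by apply/ffunP => k; rewrite ffunE; case: tpermP => [->|->|].
set S := \sum_(s | _) _; suff : S = - S.
  by move=> /eqP; rewrite -subr_eq0 opprK -mulr2n mulrn_eq0 /= => /eqP.
rewrite {1}/S (reindex_inj (mulgI (tperm i j))) -sumrN /=; apply: eq_big => s.
  rewrite /word_fixed -permute_wordM.
  apply/eqP/eqP => [e|->//].
  by rewrite -[LHS]permute_word1 -(tperm2 i j) -permute_wordM e.
by move=> _; rewrite odd_permM odd_tperm ij signr_addb expr1 mulN1r.
Qed.

(** The product of the permutation characters counts fixed pairs of words; exchanging the sums
    leaves a signed sum over the stabiliser of each pair. *)
Lemma pairing_perm_char (l k : nat) (m : {ffun 'I_l -> nat}) (c : {ffun 'I_k -> nat}) :
  '[perm_char n m, perm_char n c * sgn n] = n`!%:R^-1 *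
    #|[set F : {ffun 'I_n -> 'I_l * 'I_k} | [&& injectiveb F, content (word1 F) == m
         & content (word2 F) == c]]|%:R.
Proof.
rewrite cfdotE cardsT card_Sn; congr (_ * _).
pose ok (F : {ffun 'I_n -> 'I_l * 'I_k}) := (content (word1 F) == m) && (content (word2 F) == c).
have fixedE (F : {ffun 'I_n -> 'I_l * 'I_k}) s :
    word_fixed F s = word_fixed (word1 F) s && word_fixed (word2 F) s.
  rewrite /word_fixed; apply/eqP/andP => [/ffunP e|[/eqP/ffunP e1 /eqP/ffunP e2]].
    by split; apply/eqP/ffunP => i; have := e i; rewrite !ffunE => ->.
  apply/ffunP => i; have := e1 i; have := e2 i; rewrite !ffunE => h2 h1.
  by apply/eqP; rewrite -pair_eqE /= /pair_eq h1 h2 !eqxx.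
transitivity (\sum_(s : 'S_n) \sum_(F | ok F && word_fixed F s) (-1) ^+ s : algC).
  apply: eq_big => [s|s _]; first by rewrite inE.
  rewrite cfunE !perm_charE sgnE rmorphM rmorph_sign rmorph_nat mulrA -natrM.
  rewrite sumr_const -[RHS]mulr_natl; congr (_%:R * _); rewrite -cardsX.
  pose h (F : {ffun 'I_n -> 'I_l * 'I_k}) := (word1 F, word2 F).
  have h_inj : injective h.
    move=> F G [/ffunP e1 /ffunP e2]; apply/ffunP => i; have := e1 i; have := e2 i.
    rewrite !ffunE => h2 h1; apply/eqP; by rewrite -pair_eqE /= /pair_eq h1 h2 !eqxx.
  rewrite -(card_imset _ h_inj); apply: eq_card => -[f g].
  rewrite !inE /=; apply/andP/imsetP => [[/andP[c1 f1] /andP[c2 f2]]|[F]].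
    exists [ffun i => (f i, g i)].
      have e1 : word1 [ffun i => (f i, g i)] = f by apply/ffunP => i; rewrite !ffunE.
      have e2 : word2 [ffun i => (f i, g i)] = g by apply/ffunP => i; rewrite !ffunE.
      by rewrite unfold_in /ok fixedE e1 e2 c1 c2 f1 f2.
    by congr (_, _); apply/ffunP => i; rewrite !ffunE.
  by rewrite unfold_in /ok fixedE => /andP[/andP[c1 c2] /andP[f1 f2]] [-> ->]; rewrite c1 c2 f1 f2.
rewrite (exchange_big_dep ok) /=; last by move=> s F _ /andP[].
rewrite -sum1_card natr_sum [RHS](eq_bigl (fun F => ok F && injectiveb F)); last first.
  by move=> F; rewrite inE /ok andbC.
rewrite [RHS]big_mkcondr; apply: eq_bigr => F okF.
rewrite (eq_bigl (fun s => word_fixed F s)); last by move=> s; rewrite okF.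
by rewrite sum_sign_stab; case: (injectiveb F).
Qed.

Lemma Ind_young sh : sumn sh = n ->
  'Ind[[set: 'S_n], young n sh] 1 = perm_char n [ffun i : 'I_(size sh) => nth 0%N sh i].
Proof.
move=> /block_word[f [fE cf]].
have -> : young n sh = word_stab_group f.
  apply/group_inj/setP => s; rewrite !inE /word_fixed; apply/forallP/eqP => [h|/ffunP h k].
    by apply/ffunP => k; apply: val_inj; rewrite ffunE /= !fE; apply/eqP.
  by have /(congr1 val) := h k; rewrite ffunE /= !fE => ->.
apply/cfun_inP => s _; rewrite Ind_word_stab perm_charE.
have -> // : content f = [ffun i : 'I_(size sh) => nth 0%N sh i].
by apply/ffunP => i; rewrite cf ffunE.
Qed.

End SignedPairing.

(** * Identification of the James-Kerber character *)

Section JamesKerber.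
Variables (n : nat) (la : seq nat).
Hypothesis la_part : is_part la.
Hypothesis sum_la : sumn la = n.
Local Notation l := (size la).
Local Notation lam := (fun i : 'I_l => nth 0%N la i).
Local Notation k := (size (conj_part la)).

Definition beta_mon : 'X_{1..l} := [multinom nth 0%N la i + stair i | i < l].

Lemma la_dec (i j : 'I_l) : (i <= j)%N -> (lam j <= lam i)%N.
Proof.
case/andP: la_part => srt _ ij.
by have := @sorted_leq_nth _ geq (fun a b c h1 h2 => leq_trans h2 h1) leqnn 0%N la srt i j;
  rewrite !inE !ltn_ord; apply.
Qed.

Lemma beta_inj : injective beta_mon.
Proof.
move=> i j; rewrite !mnmE.
wlog ij : i j / (i <= j)%N => [hw e|].
  by case/orP: (leq_total i j) => ij; [apply: hw|apply/esym/hw].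
move=> e; apply: val_inj; have := la_dec ij; move: e; rewrite /stair.
by have := ltn_ord i; have := ltn_ord j; rewrite /=; lia.
Qed.

Lemma sum_lam : (\sum_i lam i = n)%N.
Proof. by rewrite -sum_la sumnE (big_nth 0%N) big_mkord. Qed.

Lemma sum_beta : (\sum_i beta_mon i = n + \sum_(i < l) stair i)%N.
Proof.
by rewrite -sum_lam -big_split /=; apply: eq_bigr => i _; rewrite mnmE.
Qed.

Lemma lam_le i : (lam i <= k)%N.
Proof.
rewrite size_mkseq -nth0; case: (posnP l) => [l0|l0]; first by case: i => i; rewrite l0.
exact: (@la_dec (Ordinal l0) i).
Qed.

Lemma conj_nth (j : 'I_k) : nth 0%N (conj_part la) j = (\sum_(r < l) (j < lam r))%N.
Proof.
rewrite nth_mkseq; last exact: leq_trans (ltn_ord j) (eq_leq (size_mkseq _ _)).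
rewrite -sum1_count big_mkcond (big_nth 0%N) big_mkord; apply: eq_bigr => r _.
by case: ltnP.
Qed.

Lemma sum_conj : sumn (conj_part la) = n.
Proof.
rewrite sumnE (big_nth 0%N) big_mkord (eq_bigr _ (fun j _ => conj_nth j)) exchange_big /=.
rewrite -sum_lam; apply: eq_bigr => r _; rewrite -[RHS](sum_ord_lt (lam_le r)) [RHS]big_mkcond.
by apply: eq_bigr => j _; case: ltnP.
Qed.

(** Guards the truncated subtraction in [shifted]: if la + delta - w delta has a negative entry, no
    word has this content and the term is 0. *)
Definition shift_ok (w : 'S_l) := [forall i, (stair (w i) <= beta_mon i)%N].
Definition shifted (w : 'S_l) : {ffun 'I_l -> nat} := [ffun i => beta_mon i - stair (w i)]%N.

Definition jacobi_trudi : 'CF([set: 'S_n]) :=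
  \sum_(w : 'S_l) (-1) ^+ w *: (if shift_ok w then perm_char n (shifted w) else 0).

Lemma jacobi_trudiE s : jacobi_trudi s = frobenius beta_mon s.
Proof.
rewrite /frobenius alternant_mpoly /fixed_sum mulr_suml raddf_sum sum_cfunE /=.
apply: eq_bigr => w _; rewrite cfunE -mulrA.
have -> : (-1) ^+ w = ((-1) ^+ w)%:MP :> {mpoly algC[l]} by rewrite rmorph_sign.
rewrite mcoeffCM; congr (_ * _); rewrite mulr_sumr raddf_sum /=.
pose mon (f : {ffun 'I_n -> 'I_l}) : 'X_{1..l} := [multinom content f i | i < l].
transitivity (\sum_(f : {ffun 'I_n -> 'I_l} | word_fixed f s)
   ([multinom stair (w i) | i < l] + mon f == beta_mon)%MM%:R : algC); last first.
  apply: eq_bigr => f _; rewrite -mcoeffX mpolyXD.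
  suff -> : 'X_[mon f] = \prod_i 'X_(f i) :> {mpoly algC[l]} by [].
  rewrite mpolyXE_id (prod_word (fun i => 'X_i : {mpoly algC[l]})).
  by apply: eq_bigr => i _; rewrite mnmE.
have monE f : ([multinom stair (w i) | i < l] + mon f == beta_mon)%MM =
    shift_ok w && (content f == shifted w).
  apply/eqP/andP => [/mnmP e|[/forallP ok /eqP e]].
    have e' i : (stair (w i) + content f i = beta_mon i)%N by rewrite -e mnmDE !mnmE.
    split; first by apply/forallP => i; rewrite -e' leq_addr.
    by apply/eqP/ffunP => i; rewrite [RHS]ffunE -e' addKn.
  by apply/mnmP => i; rewrite mnmDE ![in LHS]mnmE e ffunE subnKC //; exact: ok.
rewrite -natr_sum; case: ifP => ok; last first.
  by rewrite cfunE big1 // => f _; rewrite monE ok.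
rewrite perm_charE; congr (_%:R); rewrite -sum1_card big_mkcond [RHS]big_mkcond.
by apply: eq_bigr => f _; rewrite inE monE ok /=; case: (word_fixed f s); case: eqP.
Qed.

Lemma jacobi_trudi_real s : (jacobi_trudi s)^* = jacobi_trudi s.
Proof.
rewrite sum_cfunE rmorph_sum; apply: eq_bigr => w _.
rewrite cfunE rmorphM rmorph_sign; congr (_ * _); case: ifP => _.
  by rewrite perm_charE rmorph_nat.
by rewrite cfunE rmorph0.
Qed.

(** [sum_frobenius_sqr] makes the norm a sign, and a norm is nonnegative. *)
Lemma cfnorm_jacobi_trudi : '[jacobi_trudi] = 1.
Proof.
have [e he] := sum_frobenius_sqr beta_inj sum_beta.
have nE : '[jacobi_trudi] = (-1) ^+ e.
  rewrite cfdotE cardsT card_Sn (eq_bigr (fun s => frobenius beta_mon s ^+ 2)); last first.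
    by move=> s _; rewrite jacobi_trudi_real jacobi_trudiE expr2.
  rewrite (eq_bigl xpredT) ?he; last by move=> s; rewrite inE.
  by rewrite mulrC mulfK // pnatr_eq0 -lt0n fact_gt0.
have := cfnorm_ge0 jacobi_trudi; rewrite nE; case: e {he nE} => //.
by rewrite expr1 oppr_ge0 => h; have := lt_le_trans ltr01 h; rewrite ltxx.
Qed.

Definition signed_char : 'CF([set: 'S_n]) :=
  perm_char n [ffun j : 'I_k => nth 0%N (conj_part la) j] * sgn n.

Lemma pairing_shifted (w : 'S_l) : w != 1%g -> shift_ok w ->
  '[perm_char n (shifted w), signed_char] = 0.
Proof.
move=> w1 /forallP ok; rewrite pairing_perm_char.
set A := [set F | _]; have -> : A = finset.set0; last by rewrite cards0 mulr0.
apply/setP => F; rewrite [RHS]inE inE; apply/negP => /and3P[/injectiveP inj /eqP c1 /eqP c2].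
have F2 j : content (word2 F) j = (\sum_(r < l) (j < lam r))%N.
  by rewrite c2 ffunE conj_nth.
have le := pair_sqr_le sum_lam lam_le inj F2.
have := stair_shift_sqr la_dec (m := shifted w) w1.
rewrite -c1 ltnNge le => /(_ _)/negP; apply => //.
by move=> i; rewrite c1 ffunE subnK ?ok // mnmE.
Qed.

Lemma pairing_id : '[perm_char n [ffun i => lam i], signed_char] = 1.
Proof.
rewrite pairing_perm_char -(card_injective_pairs sum_lam lam_le).
set A := [set F | _]; set B := [set F | _].
have -> : B = A; last first.
  by rewrite mulVf // pnatr_eq0 /A (card_injective_pairs sum_lam lam_le) -lt0n fact_gt0.
apply/setP => F; rewrite !inE; congr [&& _, _ & _].
  by apply/eqP/forallP => [-> i|h]; [rewrite ffunE eqxx | apply/ffunP => i; rewrite [RHS]ffunE; apply/eqP].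
apply/eqP/forallP => [-> i|h]; first by rewrite ffunE conj_nth eqxx.
by apply/ffunP => i; rewrite [RHS]ffunE conj_nth; apply/eqP.
Qed.

Lemma sign_mx_repr : mx_repr [set: 'S_n] (fun s : 'S_n => ((-1) ^+ s)%:M : 'M[algC]_1).
Proof.
split=> [|s t _ _]; first by rewrite odd_perm1.
by rewrite odd_permM signr_addb scalar_mxM.
Qed.

Lemma sgn_char : sgn n \is a character.
Proof.
suff <- : cfRepr (MxRepresentation sign_mx_repr) = sgn n by exact: cfRepr_char.
by apply/cfun_inP => s _; rewrite cfunE inE /= mulr1n sgnE mxtrace_scalar.
Qed.

Lemma signed_char_char : signed_char \is a character.
Proof. by rewrite rpredM ?perm_char_char ?sgn_char. Qed.

Lemma Ind_young_sgn :
  'Ind[[set: 'S_n], young n (conj_part la)] ('Res[young n (conj_part la)] (sgn n)) = signed_char.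
Proof.
by rewrite -[X in 'Ind[_, _] X]mul1r cfIndM ?finset.subsetT // (Ind_young sum_conj).
Qed.

Lemma cfdot_irr_char (phi psi : 'CF([set: 'S_n])) : psi \is a character ->
  '[phi, psi] = \sum_i '[phi, 'chi_i] * '[psi, 'chi_i].
Proof.
move=> cp; rewrite cfdot_sum_irr; apply: eq_bigr => i _; congr (_ * _).
by rewrite conj_natr // Cnat_cfdot_char_irr.
Qed.

Lemma shifted1 : shift_ok 1%g /\ shifted 1%g = [ffun i => lam i].
Proof.
split; first by apply/forallP => i; rewrite perm1 mnmE leq_addl.
by apply/ffunP => i; rewrite !ffunE perm1 mnmE addnK.
Qed.

(* The common constituent of the two induced characters is unique and occurs
   only once in each, hence once in the determinant, whose norm is 1. *)
Lemma common_constituent i :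
  '[perm_char n [ffun i => lam i], 'chi_i] != 0 -> '[signed_char, 'chi_i] != 0 ->
  'chi_i = jacobi_trudi.
Proof.
set h := perm_char _ _ => a0 b0.
have cnat (phi : 'CF([set: 'S_n])) j : phi \is a character -> exists x : nat, '[phi, 'chi_j] = x%:R.
  by move=> /(Cnat_cfdot_char_irr j)/natrP.
have ge0 (phi : 'CF([set: 'S_n])) j : phi \is a character -> 0 <= '[phi, 'chi_j] * '[signed_char, 'chi_j].
  move=> cp; have [x ->] := cnat phi j cp; have [y ->] := cnat _ j signed_char_char.
  by rewrite -natrM ler0n.
have ch : h \is a character := perm_char_char _ _.
have a1 : '[h, 'chi_i] = 1.
  have le1 : '[h, 'chi_i] * '[signed_char, 'chi_i] <= 1.
    rewrite -pairing_id -/h (cfdot_irr_char h signed_char_char) (bigD1 i) //= lerDl.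
    by apply: sumr_ge0 => j _; exact: ge0.
  have [x xE] := cnat h i ch; have [y yE] := cnat _ i signed_char_char.
  move: a0 b0 le1; rewrite xE yE -natrM !pnatr_eq0 (ler_nat _ _ 1%N).
  by move=> x0 y0 xy; suff -> : x = 1%N by []; move: x0 y0 xy; clear; nia.
have d1 : '[jacobi_trudi, 'chi_i] = 1.
  rewrite cfdot_suml (bigD1 1%g) //= [X in _ + X]big1 ?addr0 => [|w w1].
    have [-> ->] := shifted1.
    by rewrite odd_perm1 expr0 scale1r.
  rewrite cfdotZl; case: ifP => ok; last by rewrite cfdot0l mulr0.
  have cp : perm_char n (shifted w) \is a character := perm_char_char _ _.
  (* The vanishing pairing is a sum of products of multiplicities, all nonnegative, so the one at i
     is 0 too. *)
  have := pairing_shifted w1 ok; rewrite cfdot_irr_char ?signed_char_char //.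
  move/psumr_eq0P => /(_ (fun j _ => ge0 _ j cp)) /(_ i isT) /eqP.
  by rewrite mulf_eq0 (negPf b0) orbF => /eqP ->; rewrite mulr0.
apply/esym/eqP; rewrite -subr_eq0 -cfnorm_eq0 cfnormB d1 cfnorm_jacobi_trudi cfnorm_irr.
by rewrite conjC1 subrr.
Qed.

Lemma chi_jacobi_trudi : chi n la = jacobi_trudi.
Proof.
rewrite /chi /part_Iirr; case: pickP => [i|no] /=.
  rewrite (Ind_young sum_la) Ind_young_sgn !irr_consttE => /andP[h1 h2].
  exact: common_constituent.
(* Without a common constituent the pairing, which is 1, would be 0; so the default index is not
   reached. *)
have := pairing_id; rewrite cfdot_irr_char ?signed_char_char // big1 => [/esym/eqP|i _].
  by rewrite oner_eq0.
have := no i; rewrite (Ind_young sum_la) Ind_young_sgn !irr_consttE => /negbT.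
by rewrite negb_and !negbK => /orP[]/eqP ->; rewrite ?mul0r ?mulr0.
Qed.

Lemma chi_frobenius s : chi n la s = frobenius beta_mon s.
Proof. by rewrite chi_jacobi_trudi jacobi_trudiE. Qed.

End JamesKerber.

(** * Power sums and Frobenius' coefficients *)

Section PowerSums.
Variables (n l : nat).
Local Notation P := {mpoly algC[l]}.

Definition psum m : P := \sum_(k < l) 'X_k ^+ m.

Lemma fixed_word_porbit (s : 'S_n) (f : {ffun 'I_n -> 'I_l}) i j :
  word_fixed f s -> j \in porbit s i -> f j = f i.
Proof.
move=> /eqP/ffunP fs /porbitP[k ->]; elim: k => [|k IH]; first by rewrite expg0 perm1.
by rewrite expgSr permM; have := fs ((s ^+ k)%g i); rewrite ffunE => ->.
Qed.

Lemma prod_porbits (s : 'S_n) (z : {set 'I_n} -> P) :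
  \prod_i z (porbit s i) = \prod_(c in porbits s) z c ^+ #|c|.
Proof.
rewrite (partition_big (porbit s) (fun c => c \in porbits s)) /=; last first.
  by move=> i _; apply/imsetP; exists i.
apply: eq_bigr => c /imsetP[j _ ->].
rewrite (eq_bigr (fun=> z (porbit s j))) => [|i /eqP -> //].
by rewrite prodr_const; congr (_ ^+ _); apply: eq_card => i; rewrite -[RHS]eq_porbit_mem.
Qed.

(** A word fixed by s is constant on the cycles of s, so it amounts to a choice of one letter per
    cycle. *)
Lemma fixed_sum_porbits (s : 'S_n) : (l = 0 -> n = 0)%N ->
  fixed_sum l s = \prod_(c in porbits s) psum #|c|.
Proof.
case: (posnP l) => [l0 n0|l_gt0 _].
  have {}n0 := n0 l0.
  have no (i : 'I_n) : False by have := ltn_ord i; rewrite [X in (_ < X)%N]n0.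
  have e : #|'I_n| = 0%N by rewrite card_ord.
  rewrite /fixed_sum (big_pred1 (ffun0 e : {ffun 'I_n -> 'I_l})) => [|f]; last first.
    by apply/idP/idP => _; apply/eqP/ffunP => i; case: (no i).
  rewrite big1 => [|i _]; last by case: (no i).
  by rewrite big_pred0 // => c; apply/negP => /imsetP[i]; case: (no i).
pose k0 := Ordinal l_gt0.
rewrite (big_distr_big_dep k0 _ (fun=> predT)).
pose h (g : {ffun {set 'I_n} -> 'I_l}) : {ffun 'I_n -> 'I_l} := [ffun i => g (porbit s i)].
pose h' (f : {ffun 'I_n -> 'I_l}) : {ffun {set 'I_n} -> 'I_l} :=
  [ffun c : {set 'I_n} => if c \in porbits s then (if [pick i in c] is Some i then f i else k0) else k0].
have h'E f i : word_fixed f s -> h' f (porbit s i) = f i.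
  move=> ff; rewrite ffunE; have -> : porbit s i \in porbits s by apply/imsetP; exists i.
  case: pickP => [j /= ji|/(_ i)]; first exact: fixed_word_porbit ff ji.
  by rewrite /= porbit_id.
rewrite /fixed_sum (reindex_onto h h') => [|f ff]; last first.
  by apply/ffunP => i; rewrite ffunE h'E.
have fixh g : word_fixed (h g) s.
  apply/eqP/ffunP => i; rewrite !ffunE; congr (g _); apply/eqP.
  by rewrite eq_porbit_mem; have := mem_porbit s 1 i; rewrite expg1.
apply: eq_big => [g|g _].
  rewrite fixh /=; apply/eqP/pfamilyP => [<-|[supp _]].
    split=> // ; apply/fintype.subsetP => c; rewrite unfold_in /= ffunE.
    by case: ifP => //; rewrite eqxx.
  apply/ffunP => c; case cp: (c \in porbits s).
    by case/imsetP: cp => i _ ->; rewrite h'E // ffunE.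
  rewrite ffunE cp; apply/esym/eqP; apply: contraFT cp => gc.
  by apply: (fintype.subsetP supp); rewrite unfold_in.
rewrite -prod_porbits; apply: eq_bigr => i _; by rewrite ffunE.
Qed.

Lemma fixed_sum_cycle_type (s : 'S_n) : (l = 0 -> n = 0)%N ->
  fixed_sum l s = \prod_(m <- cycle_type s) psum m.
Proof.
move=> /fixed_sum_porbits ->; rewrite /cycle_type.
by rewrite (perm_big _ (permEl (perm_sort _ _))) /= big_map big_enum.
Qed.

Lemma fixed_sum1 : fixed_sum l (1 : 'S_n) = psum 1 ^+ n.
Proof.
rewrite -[X in _ ^+ X]card_ord -prodr_const /psum.
under [RHS]eq_bigr => i _ do under eq_bigr => k _ do rewrite expr1.
rewrite bigA_distr_bigA; apply: eq_bigl => f.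
by rewrite /word_fixed permute_word1 eqxx.
Qed.

Definition bfact (b : 'X_{1..l}) : nat := (\prod_i (b i)`!)%N.

Lemma bfact_gt0 b : (0 < bfact b)%N.
Proof. by rewrite prodn_gt0 // => i; exact: fact_gt0. Qed.

Lemma bfact_sub (b : 'X_{1..l}) k m : (m <= b k)%N ->
  bfact b = (b k ^_ m * bfact (b - U_(k) *+ m)%MM)%N.
Proof.
move=> mb; rewrite /bfact (bigD1 k) //= [in RHS](bigD1 k) //= mulnA.
rewrite mnmBE mulmnE mnm1E eqxx mul1n ffact_fact //; congr (_ * _)%N.
apply: eq_bigr => i ik; rewrite mnmBE mulmnE mnm1E eq_sym (negPf ik) mul0n subn0 //.
Qed.

Lemma mcoeffM_Xn (Q : P) k m (b : 'X_{1..l}) :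
  (Q * 'X_k ^+ m)@_b = if (m <= b k)%N then Q@_(b - U_(k) *+ m)%MM else 0.
Proof.
rewrite mpolyXn; case: ifP => mb.
  have le : (U_(k) *+ m <= b)%MM.
    by apply/mnm_lepP => i; rewrite mulmnE mnm1E; case: eqP => [<-|]; rewrite ?mul1n ?mul0n.
  by rewrite -[in LHS](submK le) addmC mcoeffMX.
rewrite mcoeffM big1 // => c /eqP e; rewrite mcoeffX; case: eqP => [e2|_]; last by rewrite mulr0.
exfalso; move/negP: mb; apply; have /(congr1 (fun x : 'X_{1..l} => x k)) := e.
by rewrite mnmDE -e2 mulmnE mnm1E eqxx mul1n => ->; rewrite leq_addl.
Qed.

(** On coefficients scaled by b!, multiplication by p_m lowers one exponent by m at the price of a
    falling factorial, which is 0 when b_k < m and so absorbs the truncated subtraction. *)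
Lemma mcoeffM_psum (Q : P) m (b : 'X_{1..l}) : (Q * psum m)@_b * (bfact b)%:R =
  \sum_k (b k ^_ m)%:R * (Q@_(b - U_(k) *+ m)%MM * (bfact (b - U_(k) *+ m)%MM)%:R).
Proof.
rewrite mulr_sumr raddf_sum mulr_suml /=; apply: eq_bigr => k _.
rewrite mcoeffM_Xn; case: leqP => mb; last by rewrite ffact_small // !mul0r.
by rewrite (bfact_sub mb) natrM mulrCA.
Qed.

Lemma mdeg_sub (a b : 'X_{1..l}) : (a <= b)%MM -> mdeg (b - a)%MM = (mdeg b - mdeg a)%N.
Proof. by move=> le; rewrite -[in RHS](submK le) mdegD addnK. Qed.

Lemma mcoeff_psum1_exp d (b : 'X_{1..l}) : mdeg b = d ->
  (psum 1 ^+ d)@_b * (bfact b)%:R = d`!%:R.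
Proof.
elim: d b => [|d IH] b db.
  have /eqP := db; rewrite mdeg_eq0 => /eqP ->.
  rewrite expr0 mcoeff1 eqxx mul1r /bfact big1 // => i _; by rewrite mnm0E.
rewrite exprSr mcoeffM_psum factS natrM -db mdegE natr_sum mulr_suml.
apply: eq_bigr => k _; rewrite ffactn1; case: (posnP (b k)) => [->|bk]; first by rewrite !mul0r.
rewrite IH // mdeg_sub ?db ?mdegMn ?mdeg1 ?mul1n ?subn1 //.
by apply/mnm_lepP => i; rewrite mulm1n mnm1E; case: eqP => [<-|].
Qed.

Lemma ffactr_nat (R : comNzRingType) x m : ffactr (x%:R : R) m = (x ^_ m)%:R.
Proof.
elim: m => [|m IH]; first by rewrite /ffactr big_ord0.
rewrite ffactrSr IH ffactnSr natrM; case: (leqP m x) => mx; first by rewrite natrB.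
by rewrite ffact_small // !mul0r.
Qed.

(** The term of w leaves the multinomial coefficient d! / (b - w delta)!, and scaling by b! gives
    falling factorials, which vanish when b - w delta has a negative entry. *)
Lemma mcoeff_alternant_psum d (b : 'X_{1..l}) : mdeg b = (d + \sum_(i < l) stair i)%N ->
  (alternant (fun i => 'X_i : P) * psum 1 ^+ d)@_b * (bfact b)%:R =
  d`!%:R * \det (\matrix_(i < l, j < l) ffactr ((b i)%:R : algC) (stair j)).
Proof.
move=> db; rewrite alternant_mpoly mulr_suml raddf_sum /= mulr_suml mulr_sumr.
apply: eq_bigr => w _; set sw := [multinom _ | _ < _].
have -> : (-1) ^+ w = ((-1) ^+ w)%:MP :> P by rewrite rmorph_sign.
rewrite -mulrA mcoeffCM -mulrA [RHS]mulrCA; congr (_ * _).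
have -> : \prod_i (\matrix_(i, j) ffactr ((b i)%:R : algC) (stair j)) i (w i) =
   (\prod_i (b i ^_ (sw i))%N)%:R.
  by rewrite natr_prod; apply: eq_bigr => i _; rewrite mxE ffactr_nat mnmE.
case le: (sw <= b)%MM.
  have /mnm_lepP le_i := le.
  rewrite mulrC -[in X in _ * X](submK le) addmC mulrC ['X_[sw] * _]mulrC mcoeffMX.
  have -> : bfact b = (bfact (b - sw)%MM * \prod_i (b i ^_ (sw i)))%N.
    rewrite /bfact -big_split /=; apply: eq_bigr => i _.
    by rewrite mnmBE mulnC ffact_fact //; exact: le_i.
  rewrite natrM mulrA mcoeff_psum1_exp // mdeg_sub // db mdeg_stair addnK //.
have [i iw] : exists i, (b i < sw i)%N.
  apply/existsP; apply: contraFT le; rewrite negb_exists => /forallP h.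
  by apply/mnm_lepP => i; rewrite leqNgt.
rewrite [in RHS](bigD1 i) //= ffact_small // mul0n mulr0 mcoeffM big1 ?mul0r // => c /eqP e.
rewrite mcoeffX; case: eqP => [e2|_]; last by rewrite mul0r.
exfalso; move: iw; have /(congr1 (fun x : 'X_{1..l} => x i)) := e.
by rewrite mnmDE -e2 => ->; rewrite ltnNge leq_addr.
Qed.

End PowerSums.

(** * Frobenius' coefficients as iterated removals *)

Section Removals.
Variables (n l : nat).
Local Notation P := {mpoly algC[l]}.

(** Falling factorials are monic in v i, so the change of basis T from powers is unitriangular. *)
Lemma det_ffactr : exists e : bool, forall v : 'I_l -> algC,
  \det (\matrix_(i < l, j < l) ffactr (v i) (stair j)) = (-1) ^+ e * vand v.
Proof.
pose E := (\sum_(i < l) \sum_(j < l | (i < j)%N) 1)%N.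
exists (odd E (+) perm (@rev_ord_inj l)) => v.
pose T : 'M[algC]_l := \matrix_(t, j) (stirling1 (stair j) (stair t))%:~R.
have -> : \matrix_(i < l, j < l) ffactr (v i) (stair j) =
    (\matrix_(i < l, j < l) v i ^+ stair j) *m T.
  apply/matrixP => i j; rewrite !mxE stirling1_ffactr.
  rewrite (big_ord_widen l (fun t => (stirling1 (stair j) t)%:~R * v i ^+ t)); last first.
    by rewrite /stair; have := ltn_ord j; lia.
  rewrite (reindex_inj rev_ord_inj) /= big_mkcond; apply: eq_bigr => t _; rewrite !mxE.
  have -> : (l - t.+1 = stair t)%N by rewrite /stair; lia.
  case: ltnP => tj; first by rewrite mulrC.
  by rewrite stirling1_eq0 ?mulr0 //; apply/orP; right; rewrite ltz_nat.
rewrite det_mulmx -/(alternant v).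
have trig : is_trig_mx T.
  apply/is_trig_mxP => i j ij; rewrite mxE stirling1_eq0 //; apply/orP; right.
  by rewrite ltz_nat /stair; have := ltn_ord j; lia.
rewrite (det_trig trig) big1 ?mulr1 => [|i _]; last first.
  rewrite mxE /stirling1; set d := stair i; set Q := \prod_(j < d) _.
  have : Q \is monic by apply: monic_prod => j _; exact: monicXsubC.
  by rewrite monicE /lead_coef size_prod_subC card_ord => /eqP ->.
rewrite alternantE det_powersE signr_addb [_ * (-1) ^+ perm _]mulrC -mulrA; congr (_ * _).
rewrite signr_odd /E /vand -prodrXr -big_split /=; apply: eq_bigr => i _.
rewrite -prodrXr -big_split /=; apply: eq_bigr => j _; ring.
Qed.

Lemma vand_shift (v : 'I_l -> algC) c : vand (fun i => v i - c) = vand v.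
Proof. by apply: eq_bigr => i _; apply: eq_bigr => j _; ring. Qed.

(** The sign is quantified first: the same one must serve for rho and for the identity, since
    [chi_hat_removals] takes their ratio. *)
Lemma mcoeff_removals : exists e : bool, forall (s : seq nat) d (b : 'X_{1..l}),
  mdeg b = (sumn s + d + \sum_(i < l) stair i)%N ->
  (alternant (fun i => 'X_i : P) * psum l 1 ^+ d * \prod_(m <- s) psum l m)@_b * (bfact b)%:R =
  d`!%:R * ((-1) ^+ e * removals (fun i => (b i)%:R - (l%:R - 1)) s).
Proof.
have [e he] := det_ffactr; exists e; elim=> [|m s IH] d b db.
  by rewrite big_nil mulr1 mcoeff_alternant_psum // he /= vand_shift.
rewrite big_cons mulrCA [psum l m * _]mulrC mcoeffM_psum /= !mulr_sumr; apply: eq_bigr => k _.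
have -> : (b k)%:R - (l%:R - 1) + (l%:R - 1) = (b k)%:R :> algC by ring.
rewrite ffactr_nat; case: (leqP m (b k)) => mb; last first.
  by rewrite ffact_small // !(mul0r, mulr0).
have le : (U_(k) *+ m <= b)%MM.
  by apply/mnm_lepP => i; rewrite mulmnE mnm1E; case: eqP => [<-|]; rewrite ?mul1n ?mul0n.
rewrite IH; last first.
  by rewrite mdeg_sub // db mdegMn mdeg1 /=; lia.
rewrite !mulrA; have -> : (fun i => ((b - U_(k) *+ m)%MM i)%:R - (l%:R - 1)) =
   lower (fun i => (b i)%:R - (l%:R - 1)) k m%:R :> ('I_l -> algC).
  apply: funext => i; rewrite /lower mnmBE mulmnE mnm1E eq_sym.
  by case: eqP => [->|_]; rewrite ?mul0n ?subn0 // mul1n natrB //; ring.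
by congr (_ * _); ring.
Qed.

End Removals.

Lemma chi_hat_removals (n : nat) (la rho : seq nat) (s : 'S_n) :
  is_part la -> sumn la = n -> (sumn rho <= n)%N ->
  cycle_type s = rho ++ nseq (n - sumn rho) 1%N ->
  vand (@content_ends algC la) != 0 /\
  (n ^_ sumn rho)%:R * chi_hat la s =
  removals (@content_ends algC la) rho / vand (@content_ends algC la).
Proof.
move=> la_part sum_la rn ct; set al := @content_ends algC la.
have v0 : vand al != 0.
  apply: vand_neq0 => i j /eqP; rewrite /al /content_ends subr_eq addrAC eq_sym subr_eq.
  rewrite -!natrD eqr_nat => /eqP e; apply: val_inj => /=.
  by case: (leqP i j) => ij; [have := la_dec la_part ij | have := la_dec la_part (ltnW ij)];
    move: e ij => /=; lia.
split=> //; rewrite /chi_hat !chi_frobenius //.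
have l0 : (size la = 0 -> n = 0)%N by move=> /size0nil la0; rewrite -sum_la la0.
rewrite /frobenius fixed_sum_cycle_type // fixed_sum1 ct big_cat /=.
have -> : \prod_(m <- nseq (n - sumn rho) 1%N) psum (size la) m = psum (size la) 1 ^+ (n - sumn rho).
  by rewrite big_nseq -Monoid.iteropE.
have [e he] := mcoeff_removals (size la).
set b := beta_mon la.
have alE : (fun i => (b i)%:R - ((size la)%:R - 1)) = al :> ('I_(size la) -> algC).
  apply: funext => i; rewrite mnmE /al /content_ends /stair natrD.
  have il := ltn_ord i; rewrite -subn1 -subnDA natrB ?add1n // -addn1 natrD; ring.
have sb := sum_beta sum_la.
(* With no part to remove, [h2] describes the value at the identity, that is, the dimension. *)
have h1 := he rho (n - sumn rho)%N b; have h2 := he [::] n b.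
rewrite mdegE sb in h1 h2.
have {}h1 := h1 (congr1 (addn^~ _) (esym (subnKC rn))); have {}h2 := h2 erefl.
rewrite alE in h1 h2; rewrite big_nil mulr1 /= in h2.
have b0 : (bfact b)%:R != 0 :> algC by rewrite pnatr_eq0 -lt0n bfact_gt0.
have s0 : (-1) ^+ e != 0 :> algC by rewrite signr_eq0.
have f0 m : m`!%:R != 0 :> algC by rewrite pnatr_eq0 -lt0n fact_gt0.
set p1 := \prod_(m <- rho) _ in h1 *; set p2 := _ ^+ (n - _) in h1 *.
rewrite [p1 * p2]mulrC [_ * (p2 * p1)]mulrA.
move/(canRL (mulfK b0)): h1 => ->; move/(canRL (mulfK b0)): h2 => ->.
rewrite -(ffact_fact rn) natrM; have p0 : (n ^_ sumn rho)%:R != 0 :> algC.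
  by rewrite pnatr_eq0 -lt0n ffact_gt0.
by have := f0 (n - sumn rho)%N => f1; field; rewrite b0 s0 v0 p0 f1.
Qed.

Local Open Scope classical_set_scope.

Theorem theorem6 (n r : nat) (la : seq nat) (rho : r.-tuple nat) (s : 'S_n) :
  is_part la -> sumn la = n ->
  is_part rho -> (sumn rho <= n)%N ->
  cycle_type s = rho ++ nseq (n - sumn rho) 1%N ->
  (n ^_ sumn rho)%:R * chi_hat la s =
  \sum_(e \in @eps_set r)
    \sum_(i \in [set: {ffun 'I_r -> nat}])
      (Acoef rho e i *
       \prod_(k < r) c_coef la ((tnth rho k)%:R : algC) (i k)).
Proof.
move=> la_part sum_la /andP[_ rho_pos] rn ct.
have [v0 ->] := chi_hat_removals la_part sum_la rn ct.
have K := rational_functions algC.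
have rho_gt0 k : (0 < tnth rho k)%N.
  by rewrite lt0n; apply: contraNneq rho_pos => <-; exact: mem_tnth.
pose B := (\sum_(k < r) k.+1 * (tnth rho k).+1)%N.
(* The recursion on removals asks for N = B + B, and the second constant is the least one that
   [boundNc] then allows. *)
rewrite (@expansion_finite K r rho la rho_gt0 (B + B) (r * (B + B) + B + 2) (leq_addr _ _) (leqnn _)).
have F0 m : m.+1%:R != 0 :> algC by rewrite pnatr_eq0.
have := removals_expansion K F0 rho_gt0 (leqnn (B + B)) (@content_ends algC la) (leq0n r).
by rewrite drop0 map_tnth_enum => ->; rewrite mulrC mulKf.
Qed.
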